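(* Work over $\mathbb{C}$. For parameters $c,k,l,m,n,p,q$ let $T=x+y+c$ and $$P=-kxy^2-ly+mx^2y-(nxy+p+qTx)(2x+y+c),$$ $$Q=-x\,\bigl(l+p+mcx+(k+n)xy+mx^2+qTx\bigr).$$ For general values of the parameters (i.e. for all values in a nonempty Zariski open set) the differential form $Pdx+Qdy$, a general differential form of \.{Z}o\l adek's family $CR_{5}$, has two conic integral curves $$\{a_{20}x^2+a_{11}xy+c\,a_{20}x+a_{00}=0\}$$ where $(a_{20},a_{11},a_{00})\neq0$ (up to scaling) is such that the matrix $$\begin{pmatrix}a_{20}&q&-m-q\\ -a_{11}&m-n-q&k+n+q\\ a_{00}&p&-l-p\\ 0&-a_{20}&a_{11}\end{pmatrix}$$ has rank at most $2$. Such a $Pdx+Qdy$ is Darboux integrable with respect to these two conics, and $X_{CR5}\subset\overline{X_{(2,2)}}$.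
   Context: Differential forms. $V^3=\mathbb{C}[x,y,z]_3\oplus\mathbb{C}[x,y,z]_3$ is the vector space of pairs $(P,Q)$ of homogeneous cubic polynomials, written $Pdx+Qdy$; inhomogeneous $P,Q\in\mathbb{C}[x,y]$ of degree $\le3$ are regarded as elements of $V^3$ by homogenizing with $z$. A form is a Poincar\'e differential form if at $(x,y,z)=(0,0,1)$ one has $P=Q=0$, $P_x=Q_y=1$, $P_y=Q_x=0$; the set of these is the $14$-dimensional affine space $V^3_{\text{Poincar\'e}}$. Integral curves and Darboux integrability. For homogeneous $F$, the curve $\{F=0\}\subset\mathbb{P}^2$ is an integral curve of $Pdx+Qdy$ if there is a homogeneous polynomial $K_F$ of degree $2$ (the cofactor) with $PF_y-QF_x=-FK_F$ (after homogenizing). $Pdx+Qdy$ is Darboux integrable with respect to integral curves with cofactors $K_1,\dots,K_n$ if there are scalars $\alpha_i$ with $Q_x-P_y=\sum_i\alpha_iK_i$. The set $X_{(2,2)}$. It is the set of Poincar\'e forms in $V^3$ having as integral curves two smooth conics such that: neither conic is tangent to the line at infinity $\{z=0\}$; the conics are not tangent to each other; they do not meet the line at infinity at a common point. The bar denotes Zariski closure. The family. $Y_{CR5}\subset V^3$ is the family of all forms obtained from the displayed forms $Pdx+Qdy$ (all parameter values) by affine changes of the coordinates $(x,y)$, and $X_{CR5}=Y_{CR5}\cap V^3_{\text{Poincar\'e}}$. *)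

(* Defs.v *)
From HB Require Import structures.
From mathcomp Require Import all_boot all_order all_algebra.
From mathcomp Require Import mpoly.

Set Implicit Arguments.
Unset Strict Implicit.
Unset Printing Implicit Defensive.

Import GRing.Theory.
Local Open Scope ring_scope.

Section Zariski.
Context {K : fieldType} {V : vectType K}.

(* Polynomial functions are polynomials in the coordinates in some basis of V;
   the notions below do not depend on this basis. *)
Definition poly_fun (f : {mpoly K[\dim {:V}]}) (v : V) : K :=
  f.@[fun i => coord (vbasis {:V}) i v].

Definition zariski_closed (Z : V -> Prop) : Prop :=
  exists I : {mpoly K[\dim {:V}]} -> Prop,
    forall v, Z v <-> (forall f, I f -> poly_fun f v = 0).

Definition zariski_open (U : V -> Prop) : Prop :=
  zariski_closed (fun v => ~ U v).

Definition zariski_closure (S : V -> Prop) (v : V) : Prop :=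
  forall Z, zariski_closed Z -> (forall w, S w -> Z w) -> Z v.

End Zariski.

Definition ix : 'I_3 := @Ordinal 3 0 isT.
Definition iy : 'I_3 := @Ordinal 3 1 isT.
Definition iz : 'I_3 := @Ordinal 3 2 isT.

Section Forms.
Context {K : fieldType}.

Local Notation poly3 := {mpoly K[3]}.
Local Notation poly2 := {mpoly K[2]}.

(* (P, Q) stands for P dx + Q dy. *)
Definition V3 : vectType K := (dhomog 3 K 3 * dhomog 3 K 3)%type.

Definition formP (w : V3) : poly3 := w.1.
Definition formQ (w : V3) : poly3 := w.2.

(* The homogenization in degree d of a polynomial in x, y of degree at most d.
   Beware that terms of degree > d, if any, would be dropped. *)
Definition homogenize (d : nat) (p : poly2) : poly3 :=
  \sum_(m : 'X_{1..2 < d.+1})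
     p@_m *: ('X_ix ^+ m ord0 * 'X_iy ^+ m ord_max * 'X_iz ^+ (d - mdeg m)).

Lemma homogenize_dhomog d p : homogenize d p \is d.-homog.
Proof.
have homX (i : 'I_3) e : ('X_i ^+ e : poly3) \is e.-homog.
  have hX : ('X_i : poly3) \is 1.-homog by rewrite dhomogX /= mdeg1.
  by have := dhomogMn e hX; rewrite mul1n.
apply: rpred_sum => m _; apply: rpredZ.
have le_md : (mdeg m <= d)%N by rewrite -ltnS bmdeg.
have dE : (m ord0 + m ord_max + (d - mdeg m) = d)%N.
  rewrite -[RHS](subnKC le_md) [X in (_ = X + _)%N]mdegE big_ord_recr big_ord1.
  by congr (m _ + m _ + _)%N; apply: val_inj.
have := dhomogM (dhomogM (homX ix (m ord0)) (homX iy (m ord_max)))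
                (homX iz (d - mdeg m)%N).
by rewrite dE.
Qed.

Definition form_of (PQ : poly2 * poly2) : V3 :=
  (DHomog (homogenize_dhomog 3 PQ.1), DHomog (homogenize_dhomog 3 PQ.2)).

Definition origin : 'rV[K]_3 := \row_i (i == iz)%:R.

Definition poincare (w : V3) : Prop :=
  let P := formP w in let Q := formQ w in let o := origin ord0 in
  [/\ P.@[o] = 0 /\ Q.@[o] = 0,
      (P^`M(ix)).@[o] = 1 /\ (Q^`M(iy)).@[o] = 1
    & (P^`M(iy)).@[o] = 0 /\ (Q^`M(ix)).@[o] = 0].

Definition is_cofactor (w : V3) (F KF : poly3) : Prop :=
  KF \is 2.-homog /\
  formP w * F^`M(iy) - formQ w * F^`M(ix) = - (F * KF).

Definition integral_curve (w : V3) (F : poly3) : Prop :=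
  [/\ F != 0, exists d, F \is d.-homog & exists KF, is_cofactor w F KF].

Definition darboux_integrable (w : V3) n (F : n.-tuple poly3) : Prop :=
  (forall i, integral_curve w (tnth F i)) /\
  exists (KF : 'I_n -> poly3) (alpha : 'I_n -> K),
    (forall i, is_cofactor w (tnth F i) (KF i)) /\
    (formQ w)^`M(ix) - (formP w)^`M(iy) = \sum_(i < n) alpha i *: KF i.

(* Points of the projective plane are given by nonzero row vectors. *)
Definition on_curve (F : poly3) (v : 'rV[K]_3) : Prop :=
  v != 0 /\ F.@[v ord0] = 0.

Definition smooth_curve (F : poly3) : Prop :=
  forall v, on_curve F v -> exists i, (F^`M(i)).@[v ord0] != 0.

Definition conic (F : poly3) : Prop := F != 0 /\ F \is 2.-homog.

(* The projective tangent line to F at v, when v is a smooth point of F. *)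
Definition tangent_line (F : poly3) (v u : 'rV[K]_3) : Prop :=
  \sum_i (F^`M(i)).@[v ord0] * u ord0 i = 0.

Definition tangent (F G : poly3) : Prop :=
  exists v, [/\ on_curve F v, on_curve G v
              & forall u, tangent_line F v u <-> tangent_line G v u].

Definition line_at_infinity : poly3 := 'X_iz.

Definition X22 (w : V3) : Prop :=
  poincare w /\
  exists F G : poly3,
    [/\ (conic F /\ smooth_curve F) /\ (conic G /\ smooth_curve G),
        integral_curve w F /\ integral_curve w G,
        ~ tangent F line_at_infinity /\ ~ tangent G line_at_infinity,
        ~ tangent F G
      & ~ exists v, [/\ on_curve line_at_infinity v, on_curve F v
                      & on_curve G v]].

Section CR5.
Variables c k l m n p q : K.

Local Notation x := ('X_ord0 : poly2).
Local Notation y := ('X_ord_max : poly2).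

Definition CR5_T : poly2 := x + y + c%:MP.

Definition CR5_P : poly2 :=
  - k%:MP * x * y ^+ 2 - l%:MP * y + m%:MP * x ^+ 2 * y
  - (n%:MP * x * y + p%:MP + q%:MP * CR5_T * x) * (2%:R * x + y + c%:MP).

Definition CR5_Q : poly2 :=
  - x * (l%:MP + p%:MP + m%:MP * c%:MP * x + (k%:MP + n%:MP) * x * y
         + m%:MP * x ^+ 2 + q%:MP * CR5_T * x).

Definition CR5_form : poly2 * poly2 := (CR5_P, CR5_Q).

(* A row vector a stands for (a20, a11, a00). *)
Definition CR5_conic (a : 'rV[K]_3) : poly3 :=
  let a20 := a ord0 ix in let a11 := a ord0 iy in let a00 := a ord0 iz in
  homogenize 2
    (a20%:MP * x ^+ 2 + a11%:MP * x * y + c%:MP * a20%:MP * x + a00%:MP).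

Definition CR5_matrix (a : 'rV[K]_3) : 'M[K]_(4, 3) :=
  let a20 := a ord0 ix in let a11 := a ord0 iy in let a00 := a ord0 iz in
  \matrix_(i, j) nth 0 (nth [::]
    [:: [:: a20;   q;         - m - q  ];
        [:: - a11; m - n - q; k + n + q];
        [:: a00;   p;         - l - p  ];
        [:: 0;     - a20;     a11      ]] i) j.

End CR5.

(* The pullback of P dx + Q dy along (x, y) |-> A (x, y) + t. *)
Definition affine_pullback (A : 'M[K]_2) (t : 'cV[K]_2) (PQ : poly2 * poly2) :
    poly2 * poly2 :=
  let phi := [tuple \sum_j A i j *: 'X_j + (t i ord0)%:MP | i < 2] in
  let P := PQ.1 \mPo phi in let Q := PQ.2 \mPo phi in
  (A ord0 ord0 *: P + A ord_max ord0 *: Q,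
   A ord0 ord_max *: P + A ord_max ord_max *: Q).

Definition Y_CR5 (w : V3) : Prop :=
  exists c k l m n p q A t,
    A \in unitmx /\
    w = form_of (affine_pullback A t (CR5_form c k l m n p q)).

Definition X_CR5 (w : V3) : Prop := Y_CR5 w /\ poincare w.

End Forms.

Arguments V3 K : clear implicits.

(* Main.v *)
Require Import Defs.
From mathcomp Require Import all_boot all_order all_algebra.
From mathcomp Require Import reals complex.
From mathcomp Require Import ring.
From mathcomp Require Import mpoly.

(** Write U = xy and V = x(x+y+c), homogenized with z. A form of the family is
    the pullback by (U, V) of an arbitrary affine form E dU + H dV of the plane,
    E and H being affine functions of U and V ([form_of_affine_pullback]); an
    affine change of x, y only changes the two conics U and V.

    Invariant conics. A line a + bU + cV invariant by E dU + H dV pulls back to an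
    invariant conic ([pull_cofactor]), with cofactor a multiple of the Jacobian
    {U, V}. Invariant lines are eigenvectors of a matrix built from the
    parameters. For general parameters it has two distinct nonzero eigenvalues, the
    rank condition on the 4 x 3 matrix says exactly that (a20, a11, a00) is an
    eigenvector for one of them ([eigen_row_rank]), and the curl Q_x - P_y is also a multiple of
    {U, V}, so the form is Darboux integrable.

    Closure. Both conics of a general member are tangent at infinity to the line
    x = 0, so a member is only a limit of forms of X22 and has to be deformed,
    keeping the Poincare conditions. This is possible because the pullback of
    E dU + H dV keeps a center at the origin when U and V vary in suitable
    families of conics. After moving the singular point to the origin, put
    U(0) = V(0) = 0.

    If E and H vanish at the origin, the Poincare conditions make E dU + H dV
    equal to d(FG)/2, where F and G are combinations of U and V with linear parts
    x + iy and x - iy ([regular_center_closure]). Every form d(FG)/2 with these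
    linear parts satisfies the Poincare conditions, and for general quadratic
    parts it is in X22 ([hamiltonian_form_closure]).

    Otherwise E(0)U + H(0)V has no linear part and can be taken as the new U, so
    that the form is (1 + aU + bV)dU + (cU + dV)dV with
    U = (x^2 + y^2 - d l^2)/2, where l is the linear part of V
    ([singular_center_closure]). Here a, b, c, d, l and the quadratic part of V
    are free parameters. If d is nonzero, a change of V reduces to d = 1 and
    b = 0, and then a = t1 t2 and c = -(t1 + t2), with the two invariant conics
    1 + tV - t^2 U for t = t1, t2; for general values of the parameters these
    conics are in general position ([diagonal_form_closure]).

    In each case the closure statement follows by joining the given parameters to
    good ones by a line: a polynomial condition that holds at one point of the
    line holds at all but finitely many ([zariski_closure_curve]). General
    position of two conics is one such condition, the nonvanishing of
    [generic_pair]. *)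

Set Implicit Arguments.
Unset Strict Implicit.
Unset Printing Implicit Defensive.

Import Order.TTheory GRing.Theory Num.Theory.
Local Open Scope ring_scope.

(** * Polynomial curves and Zariski closure *)

Section PolynomialFamilies.
Context {K : fieldType}.

(** Polynomial dependence on one parameter, for values in a commutative algebra:
    it is used both for scalars and for polynomials in x, y, z. *)
Definition polyfam (A : comAlgType K) (g : K -> A) : Prop :=
  exists p : {poly A}, forall s, g s = p.[s%:A].

Section Closure.
Context {A : comAlgType K}.
Implicit Types g h : K -> A.

Lemma polyfam_cst (a : A) : polyfam (fun=> a).
Proof. by exists a%:P => s; rewrite hornerC. Qed.

Lemma polyfamD g h : polyfam g -> polyfam h -> polyfam (fun s => g s + h s).
Proof. by move=> [p gE] [q hE]; exists (p + q) => s; rewrite hornerD gE hE. Qed.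

Lemma polyfamM g h : polyfam g -> polyfam h -> polyfam (fun s => g s * h s).
Proof. by move=> [p gE] [q hE]; exists (p * q) => s; rewrite hornerM gE hE. Qed.

Lemma polyfamN g : polyfam g -> polyfam (fun s => - g s).
Proof. by move=> [p gE]; exists (- p) => s; rewrite hornerN gE. Qed.

Lemma polyfamX g n : polyfam g -> polyfam (fun s => g s ^+ n).
Proof. by move=> [p gE]; exists (p ^+ n) => s; rewrite horner_exp gE. Qed.

Lemma polyfam_sum (I : Type) (r : seq I) (P : pred I) (F : I -> K -> A) :
  (forall i, polyfam (F i)) -> polyfam (fun s => \sum_(i <- r | P i) F i s).
Proof.
move=> FP; elim: r => [|i r [p IH]].
  by exists 0 => s; rewrite big_nil horner0.
have [q iE] := FP i; exists (if P i then q + p else p) => s.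
by rewrite big_cons; case: (P i); rewrite ?hornerD IH ?iE.
Qed.

Lemma polyfam_prod (I : Type) (r : seq I) (P : pred I) (F : I -> K -> A) :
  (forall i, polyfam (F i)) -> polyfam (fun s => \prod_(i <- r | P i) F i s).
Proof.
move=> FP; elim: r => [|i r [p IH]].
  by exists 1 => s; rewrite big_nil hornerC.
have [q iE] := FP i; exists (if P i then q * p else p) => s.
by rewrite big_cons; case: (P i); rewrite ?hornerM IH ?iE.
Qed.
End Closure.

Definition polyfun (g : K -> K) : Prop := @polyfam K^o g.

Lemma polyfunD g h : polyfun g -> polyfun h -> polyfun (fun s => g s + h s).
Proof. exact: (@polyfamD K^o). Qed.

Lemma polyfunN g : polyfun g -> polyfun (fun s => - g s).
Proof. exact: (@polyfamN K^o). Qed.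

Lemma polyfunM g h : polyfun g -> polyfun h -> polyfun (fun s => g s * h s).
Proof. exact: (@polyfamM K^o). Qed.

Lemma polyfunX g n : polyfun g -> polyfun (fun s => g s ^+ n).
Proof. exact: (@polyfamX K^o). Qed.

Lemma polyfun_cst (c : K) : polyfun (fun=> c).
Proof. exact: (@polyfam_cst K^o). Qed.

Lemma polyfun_id : polyfun (fun s => s).
Proof. by exists 'X => s; rewrite hornerX /GRing.scale /= mulr1. Qed.

Lemma polyfam_scale (A : comAlgType K) (g : K -> K) (a : A) :
  polyfun g -> polyfam (fun s => g s *: a).
Proof.
move=> [p gE]; exists (map_poly (fun c => c *: a) p) => s.
rewrite gE (horner_coef_wide _ (leqnn _)) horner_poly scaler_suml.
apply: eq_bigr => i _.
have -> : (s%:A : K^o) = s by rewrite /GRing.scale /= mulr1.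
by rewrite exprZn expr1n -scalerAr mulr1 [RHS]scalerA mulrC.
Qed.

End PolynomialFamilies.

Ltac polyfun_tac := repeat first [exact: polyfun_id | exact: polyfun_cst | assumption
  | apply: polyfunD | apply: polyfunN | apply: polyfunM | apply: polyfunX ].

Section Curve.
Context {K : numFieldType}.

(** The coefficients of the polynomials describing [formP] and [formQ] need not be
    cubic forms; replacing them by their homogeneous parts of degree 3 leaves the
    values unchanged, and writes the curve as a polynomial with coefficients in
    [V3 K]. *)
Lemma polyfam_V3_linear (L : {linear V3 K -> K^o}) (gam : K -> V3 K) :
  polyfam (fun s => formP (gam s)) -> polyfam (fun s => formQ (gam s)) ->
  polyfun (fun s => L (gam s)).
Proof.
move=> [p pE] [q qE].
pose D r : dhomog 3 K 3 := DHomog (pihomogP mdeg 3 r).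
have horner_pihomog (r : {poly {mpoly K[3]}}) s :
    pihomog mdeg 3 r.[s%:A] = val (\sum_(i < size r) s ^+ i *: D r`_i).
  rewrite horner_coef linear_sum (raddf_sum (@mpoly_of_dhomog 3 K 3)) /=.
  by apply: eq_bigr => i _; rewrite exprZn expr1n -scalerAr mulr1 linearZ.
have gam1 s : (gam s).1 = \sum_(i < size p) s ^+ i *: D p`_i.
  apply: val_inj; rewrite /= -horner_pihomog -pE pihomog_dE //.
  by case: (gam s) => -[? ?] [? ?].
have gam2 s : (gam s).2 = \sum_(i < size q) s ^+ i *: D q`_i.
  apply: val_inj; rewrite /= -horner_pihomog -qE pihomog_dE //.
  by case: (gam s) => -[? ?] [? ?].
pose in1 u : V3 K := (u, 0); pose in2 u : V3 K := (0, u).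
have gamE s : gam s = \sum_(i < size p) s ^+ i *: in1 (D p`_i)
                    + \sum_(i < size q) s ^+ i *: in2 (D q`_i).
  rewrite [gam s]surjective_pairing gam1 gam2.
  have -> : \sum_(i < size p) s ^+ i *: in1 (D p`_i) =
            in1 (\sum_(i < size p) s ^+ i *: D p`_i).
    by elim/big_rec2: _ => // i u v _ ->; congr pair; rewrite /= ?scaler0 ?addr0.
  have -> : \sum_(i < size q) s ^+ i *: in2 (D q`_i) =
            in2 (\sum_(i < size q) s ^+ i *: D q`_i).
    by elim/big_rec2: _ => // i u v _ ->; congr pair; rewrite /= ?scaler0 ?addr0.
  by congr pair; rewrite ?addr0 ?add0r.
suff : polyfun (fun s => \sum_(i < size p) s ^+ i * L (in1 (D p`_i))
                    + \sum_(i < size q) s ^+ i * L (in2 (D q`_i))).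
  move=> [r rE]; exists r => s; rewrite -rE gamE linearD !linear_sum.
  by congr (_ + _); apply: eq_bigr => i _; rewrite linearZ.
have polyX i c : polyfun (fun s : K => s ^+ i * c).
  by polyfun_tac.
by apply: polyfunD; apply: (@polyfam_sum _ K^o) => i; exact: polyX.
Qed.

(** A polynomial f that vanishes on S vanishes at every point of the curve where D
    does not; so D times f is a polynomial function of the parameter that vanishes
    identically, and f vanishes on the whole curve. *)
Lemma zariski_closure_curve (S : V3 K -> Prop) (gam : K -> V3 K) (D : K -> K) s0 s1 :
  polyfam (fun s => formP (gam s)) -> polyfam (fun s => formQ (gam s)) ->
  polyfun D -> D s1 != 0 ->
  (forall s, D s != 0 -> zariski_closure S (gam s)) ->
  zariski_closure S (gam s0).
Proof.
move=> gamP gamQ [d dE] Ds1 gamS Z [I ZE] SZ; apply/ZE => f If.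
have [p pE] : polyfun (fun s => poly_fun f (gam s)).
  rewrite /poly_fun.
  suff : polyfun (fun s => \sum_(m <- msupp f) f@_m *
     \prod_i (coord (vbasis {:V3 K}) i (gam s)) ^+ m i).
    by move=> [p pE]; exists p => s; rewrite -pE mevalE.
  apply: (@polyfam_sum _ K^o) => m; apply: polyfunM; first exact: polyfun_cst.
  apply: (@polyfam_prod _ K^o) => i; apply: polyfunX.
  exact: (polyfam_V3_linear (coord (vbasis {:V3 K}) i)).
have dp s : (d * p).[s%:A] = 0 :> K.
  rewrite hornerM -pE -dE; case: (eqVneq (D s) 0) => [->|Ds]; first by rewrite mul0r.
  have /ZE/(_ f If) -> := gamS s Ds Z (ex_intro _ I ZE) SZ.
  by rewrite mulr0.
have scalarE (s : K) : (s%:A : K^o) = s by rewrite /GRing.scale /= mulr1.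
have : d * p = 0 :> {poly K}.
  apply: (@roots_geq_poly_eq0 K _ [seq i%:R | i <- iota 0 (size (d * p))]).
  - apply/allP => _ /mapP[i _ ->]; rewrite /root -[X in _.[X]]scalarE dp //.
  - rewrite map_inj_uniq ?iota_uniq // => i j /eqP; rewrite eqr_nat => /eqP //.
  - by rewrite size_map size_iota.
move=> /eqP; rewrite mulf_eq0 => /orP[] /eqP z0.
  by move: Ds1; rewrite dE z0 horner0 eqxx.
by rewrite pE z0 horner0.
Qed.
End Curve.

(** * Homogenization *)

Section Dehomogenize.
Context {K : fieldType}.
Local Notation x := ('X_ord0 : {mpoly K[2]}).
Local Notation y := ('X_ord_max : {mpoly K[2]}).

Definition dehomogenize (F : {mpoly K[3]}) : {mpoly K[2]} :=
  F \mPo [tuple x; y; 1].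

Lemma homogenize_sum d (I : Type) (r : seq I) (a : I -> K) (F : I -> {mpoly K[2]}) :
  homogenize d (\sum_(i <- r) a i *: F i) =
  \sum_(i <- r) a i *: homogenize d (F i).
Proof.
rewrite /homogenize; under [RHS]eq_bigr do rewrite scaler_sumr.
rewrite exchange_big; apply: eq_bigr => m _; rewrite raddf_sum scaler_suml /=.
by apply: eq_bigr => i _; rewrite mcoeffZ scalerA.
Qed.

Lemma homogenizeX d (m : 'X_{1..2}) : (mdeg m < d.+1)%N ->
  homogenize d 'X_[m] =
  'X_ix ^+ m ord0 * 'X_iy ^+ m ord_max * 'X_iz ^+ (d - mdeg m) :> {mpoly K[3]}.
Proof.
move=> md; rewrite /homogenize (bigD1 (BMultinom md)) //= big1 ?addr0.
  by rewrite mcoeffX eqxx scale1r.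
move=> m' /eqP neq; rewrite mcoeffX; case: eqP => [mm'|]; last by rewrite scale0r.
by case: neq; apply: val_inj; rewrite /= mm'.
Qed.

(** This identity computes every homogenization that occurs: as dehomogenizing is
    a ring morphism, it is enough to exhibit the homogeneous polynomial. *)
Lemma dehomogenizeK d (F : {mpoly K[3]}) :
  F \is d.-homog -> homogenize d (dehomogenize F) = F.
Proof.
move=> Fd; rewrite [in LHS](mpolyE F) /dehomogenize raddf_sum /=.
under eq_bigr do rewrite comp_mpolyZ.
rewrite homogenize_sum [RHS]mpolyE; apply: eq_big_seq => m mF.
congr (_ *: _); have md := dhomog_mf Fd mF; rewrite /= in md.
rewrite comp_mpolyX !big_ord_recl big_ord0 /= !(tnth_nth 0) /= expr1n !mulr1.
pose m' : 'X_{1..2} := [multinom [tuple m ix; m iy]].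
have m'0 : m' ord0 = m ix by [].
have m'1 : m' ord_max = m iy by [].
have mdE : (m ix + m iy + m iz = d)%N.
  rewrite -md mdegE !big_ord_recl big_ord0 addn0 addnA.
  by congr (m _ + m _ + m _)%N; apply: val_inj.
have m'd : mdeg m' = (m ix + m iy)%N.
  rewrite mdegE big_ord_recr big_ord1 -m'0 -m'1.
  by congr (m' _ + m' _)%N; apply: val_inj.
have -> : x ^+ m ord0 * y ^+ m (lift ord0 ord0) = 'X_[m'].
  rewrite [RHS]mpolyXE_id big_ord_recr big_ord1 /=.
  by congr ('X_ _ ^+ _ * 'X_ _ ^+ _); try apply: val_inj;
    rewrite // -?m'0 -?m'1; congr (_ _); apply: val_inj.
rewrite homogenizeX ?m'd ?ltnS -?mdE ?leq_addr // m'0 m'1 addKn.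
rewrite [RHS]mpolyXE_id !big_ord_recl big_ord0 mulr1 mulrA.
by congr ('X_ _ ^+ m _ * 'X_ _ ^+ m _ * 'X_ _ ^+ m _); apply: val_inj.
Qed.
End Dehomogenize.

(** * Pairs of plane conics *)

Section Conics.
Context {K : numFieldType}.
Local Notation x := ('X_ix : {mpoly K[3]}).
Local Notation y := ('X_iy : {mpoly K[3]}).
Local Notation z := ('X_iz : {mpoly K[3]}).
Implicit Types q p : seq K.

(** The body is locked, so that comparing two conics compares their coefficient
    sequences instead of unfolding polynomial arithmetic. *)
Definition quad : seq K -> {mpoly K[3]} := locked (fun q =>
  q`_0 *: x ^+ 2 + q`_1 *: (x * y) + q`_2 *: y ^+ 2
  + q`_3 *: (x * z) + q`_4 *: (y * z) + q`_5 *: z ^+ 2).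

Definition lin (a b c : K) : {mpoly K[3]} := a *: x + b *: y + c *: z.

Lemma sum_ord3 (f : 'I_3 -> K) : \sum_i f i = f ix + f iy + f iz.
Proof.
rewrite !big_ord_recl big_ord0 addr0 addrA.
by congr (f _ + f _ + f _); apply: val_inj.
Qed.

Lemma ord3P (P : 'I_3 -> Prop) : P ix -> P iy -> P iz -> forall i, P i.
Proof.
move=> Px Py Pz [[|[|[|//]]] lti].
- by rewrite (_ : Ordinal lti = ix) //; apply: val_inj.
- by rewrite (_ : Ordinal lti = iy) //; apply: val_inj.
- by rewrite (_ : Ordinal lti = iz) //; apply: val_inj.
Qed.

Lemma homogX1 (i : 'I_3) : ('X_i : {mpoly K[3]}) \is 1.-homog.
Proof. by rewrite dhomogX /= mdeg1. Qed.

Lemma homog2M (p q : {mpoly K[3]}) :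
  p \is 1.-homog -> q \is 1.-homog -> p * q \is 2.-homog.
Proof. by move=> p1 q1; apply: dhomogM p1 q1. Qed.

Lemma homog3M (p q : {mpoly K[3]}) :
  p \is 2.-homog -> q \is 1.-homog -> p * q \is 3.-homog.
Proof. by move=> p2 q1; apply: dhomogM p2 q1. Qed.

Lemma lin_homog a b c : lin a b c \is 1.-homog.
Proof. by rewrite !rpredD // rpredZ // homogX1. Qed.

Lemma quad_homog q : quad q \is 2.-homog.
Proof.
by rewrite /quad -lock !rpredD // rpredZ // ?expr2 homog2M // homogX1.
Qed.

Lemma mderivXU (i j : 'I_3) : ('X_i : {mpoly K[3]})^`M(j) = (i == j)%:R%:MP.
Proof.
rewrite mderivX mnm1E eq_sym; case: eqP => [->|_]; last by rewrite scale0r raddf0.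
by rewrite -[X in (X - _)%MM]addm0 addmC addmK scale1r mpolyX0 rmorph1.
Qed.

Lemma quad_dx q : (quad q)^`M(ix) = lin (2 * q`_0) q`_1 q`_3.
Proof.
rewrite /quad -lock /lin !(mderivD, mderivZ, mderivM, expr2, mderivXU) /=.
by rewrite -!mul_mpolyC; ring.
Qed.

Lemma quad_dy q : (quad q)^`M(iy) = lin q`_1 (2 * q`_2) q`_4.
Proof.
rewrite /quad -lock /lin !(mderivD, mderivZ, mderivM, expr2, mderivXU) /=.
by rewrite -!mul_mpolyC; ring.
Qed.

Lemma quad_dz q : (quad q)^`M(iz) = lin q`_3 q`_4 (2 * q`_5).
Proof.
rewrite /quad -lock /lin !(mderivD, mderivZ, mderivM, expr2, mderivXU) /=.
by rewrite -!mul_mpolyC; ring.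
Qed.

Definition quadE := (quad_dx, quad_dy, quad_dz).

Lemma meval_lin a b c (v : 'I_3 -> K) :
  (lin a b c).@[v] = a * v ix + b * v iy + c * v iz.
Proof. by rewrite /lin !(mevalD, mevalZ, mevalXU). Qed.

Lemma meval_quad q (v : 'I_3 -> K) :
  (quad q).@[v] = q`_0 * v ix ^+ 2 + q`_1 * (v ix * v iy) + q`_2 * v iy ^+ 2
                + q`_3 * (v ix * v iz) + q`_4 * (v iy * v iz) + q`_5 * v iz ^+ 2.
Proof. by rewrite /quad -lock !(mevalD, mevalZ, mevalM, mevalXU, expr2). Qed.

(** Half the determinant of the Hessian matrix. *)
Definition quad_det q : K :=
  4 * q`_0 * q`_2 * q`_5 - q`_0 * q`_4 ^+ 2 - q`_1 ^+ 2 * q`_5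
  + q`_1 * q`_3 * q`_4 - q`_2 * q`_3 ^+ 2.

(** The derivative of [quad_det] at q in the direction p. *)
Definition quad_dpol q p : K :=
  4 * (p`_0 * q`_2 * q`_5 + q`_0 * p`_2 * q`_5 + q`_0 * q`_2 * p`_5)
  - (p`_0 * q`_4 ^+ 2 + 2 * q`_0 * q`_4 * p`_4)
  - (2 * q`_1 * p`_1 * q`_5 + q`_1 ^+ 2 * p`_5)
  + (p`_1 * q`_3 * q`_4 + q`_1 * p`_3 * q`_4 + q`_1 * q`_3 * p`_4)
  - (p`_2 * q`_3 ^+ 2 + 2 * q`_2 * q`_3 * p`_3).

Definition disc_infinity q : K := 4 * q`_0 * q`_2 - q`_1 ^+ 2.

(** The resultant of the restrictions of the two conics to the line z = 0. *)
Definition res_infinity q p : K :=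
  (q`_0 * p`_2 - q`_2 * p`_0) ^+ 2
  - (q`_0 * p`_1 - q`_1 * p`_0) * (q`_1 * p`_2 - q`_2 * p`_1).

Definition cubic_disc (a b c d : K) : K :=
  b ^+ 2 * c ^+ 2 - 4 * a * c ^+ 3 - 4 * b ^+ 3 * d - 27 * a ^+ 2 * d ^+ 2
  + 18 * a * b * c * d.

(** The discriminant of the cubic [quad_det (q + t p)] in t, whose roots are the
    singular members q + t p of the pencil. *)
Definition pencil_disc q p : K :=
  cubic_disc (quad_det p) (quad_dpol p q) (quad_dpol q p) (quad_det q).

Lemma cubic_disc_double_root a b c d t :
  a * t ^+ 3 + b * t ^+ 2 + c * t + d = 0 -> 3 * a * t ^+ 2 + 2 * b * t + c = 0 ->
  cubic_disc a b c d = 0.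
Proof.
move=> r0 r1.
have cE : c = - (3 * a * t ^+ 2 + 2 * b * t).
  by apply/eqP; rewrite -addr_eq0 addrC r1.
have dE : d = - (a * t ^+ 3 + b * t ^+ 2 + c * t).
  by apply/eqP; rewrite -addr_eq0 addrC r0.
by rewrite /cubic_disc dE cE; ring.
Qed.

Lemma quad_det_neq0_smooth q : quad_det q != 0 -> smooth_curve (quad q).
Proof.
move=> Dq v [vn0 _].
case: (eqVneq (quad q)^`M(ix).@[v ord0] 0) => [vx|]; last by exists ix.
case: (eqVneq (quad q)^`M(iy).@[v ord0] 0) => [vy|]; last by exists iy.
exists iz; apply: contra_neq vn0 => vz; move: vx vy vz; rewrite !quadE !meval_lin.
set X := v ord0 ix; set Y := v ord0 iy; set Z := v ord0 iz => eX eY eZ.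
have v0 w : 2 * quad_det q * w = 0 -> w = 0.
  by move/eqP; rewrite !mulf_eq0 pnatr_eq0 (negPf Dq) => /eqP.
(* Cramer's rule: each coordinate, multiplied by the determinant of the Hessian,
   is a combination of the partial derivatives with cofactors of the Hessian. *)
pose gx := 2 * q`_0 * X + q`_1 * Y + q`_3 * Z.
pose gy := q`_1 * X + 2 * q`_2 * Y + q`_4 * Z.
pose gz := q`_3 * X + q`_4 * Y + 2 * q`_5 * Z.
have X0 : X = 0.
  apply: v0; transitivity ((4 * q`_2 * q`_5 - q`_4 ^+ 2) * gx +
    (q`_3 * q`_4 - 2 * q`_1 * q`_5) * gy + (q`_1 * q`_4 - 2 * q`_2 * q`_3) * gz).
    by rewrite /quad_det /gx /gy /gz; ring.
  by rewrite /gx /gy /gz eX eY eZ !mulr0 !addr0.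
have Y0 : Y = 0.
  apply: v0; transitivity ((q`_3 * q`_4 - 2 * q`_1 * q`_5) * gx +
    (4 * q`_0 * q`_5 - q`_3 ^+ 2) * gy + (q`_1 * q`_3 - 2 * q`_0 * q`_4) * gz).
    by rewrite /quad_det /gx /gy /gz; ring.
  by rewrite /gx /gy /gz eX eY eZ !mulr0 !addr0.
have Z0 : Z = 0.
  apply: v0; transitivity ((q`_1 * q`_4 - 2 * q`_2 * q`_3) * gx +
    (q`_1 * q`_3 - 2 * q`_0 * q`_4) * gy + (4 * q`_0 * q`_2 - q`_1 ^+ 2) * gz).
    by rewrite /quad_det /gx /gy /gz; ring.
  by rewrite /gx /gy /gz eX eY eZ !mulr0 !addr0.
by apply/rowP; apply: ord3P; rewrite mxE.
Qed.

Lemma disc_infinity_not_tangent q :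
  disc_infinity q != 0 -> ~ tangent (quad q) line_at_infinity.
Proof.
move=> Dq [v [[vn0 _] [_ vz0] tan]].
move: vz0; rewrite mevalXU => vz0.
have dz u : tangent_line line_at_infinity v u <-> u ord0 iz = 0.
  by rewrite /tangent_line sum_ord3 !mderivXU !mevalC /= !mul0r !add0r mul1r.
have grad i : i != iz -> (quad q)^`M(i).@[v ord0] = 0.
  move=> iz'; have : tangent_line line_at_infinity v (delta_mx 0 i).
    by apply/dz; rewrite mxE /= [iz == i]eq_sym (negPf iz').
  move/tan; rewrite /tangent_line (bigD1 i) //= big1 ?addr0 => [|j ji].
    by rewrite mxE !eqxx mulr1.
  by rewrite mxE (negPf ji) andbF mulr0.
have := grad iy isT; have := grad ix isT; rewrite !quadE !meval_lin vz0 !mulr0 !addr0.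
set X := v ord0 ix; set Y := v ord0 iy => eX eY.
have v0 w : disc_infinity q * w = 0 -> w = 0.
  by move/eqP; rewrite mulf_eq0 (negPf Dq) => /eqP.
have X0 : X = 0.
  apply: v0; transitivity (2 * q`_2 * (2 * q`_0 * X + q`_1 * Y)
                           - q`_1 * (q`_1 * X + 2 * q`_2 * Y)).
    by rewrite /disc_infinity; ring.
  by rewrite eX eY !mulr0 subr0.
have Y0 : Y = 0.
  apply: v0; transitivity (2 * q`_0 * (q`_1 * X + 2 * q`_2 * Y)
                           - q`_1 * (2 * q`_0 * X + q`_1 * Y)).
    by rewrite /disc_infinity; ring.
  by rewrite eX eY !mulr0 subr0.
by move/eqP: vn0; apply; apply/rowP; apply: ord3P; rewrite mxE.
Qed.

Lemma res_infinity_no_common_point q p : res_infinity q p != 0 ->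
  ~ exists v, [/\ on_curve line_at_infinity v, on_curve (quad q) v
                & on_curve (quad p) v].
Proof.
move=> Dqp [v [[vn0 vz0] [_ qv] [_ pv]]].
move: vz0 qv pv; rewrite mevalXU !meval_quad => vz0; rewrite vz0.
rewrite expr0n /= !mulr0 !addr0.
set X := v ord0 ix; set Y := v ord0 iy => qv pv.
have v0 w : res_infinity q p * w ^+ 3 = 0 -> w = 0.
  by move/eqP; rewrite mulf_eq0 (negPf Dqp) expf_eq0 => /eqP.
set A := q`_0 * p`_2 - q`_2 * p`_0; set B := q`_0 * p`_1 - q`_1 * p`_0.
set C := q`_1 * p`_2 - q`_2 * p`_1.
set f := q`_0 * X ^+ 2 + _ + _ in qv; set g := p`_0 * X ^+ 2 + _ + _ in pv.
have X0 : X = 0.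
  apply: v0; transitivity ((A * X - C * Y) * (p`_2 * f - q`_2 * g)
                           - C * X * (p`_1 * f - q`_1 * g)).
    by rewrite /res_infinity /A /B /C /f /g; ring.
  by rewrite qv pv !(mulr0, subr0).
have Y0 : Y = 0.
  apply: v0; transitivity ((B * X - A * Y) * (p`_0 * f - q`_0 * g)
                           + B * Y * (p`_1 * f - q`_1 * g)).
    by rewrite /res_infinity /A /B /C /f /g; ring.
  by rewrite qv pv !(mulr0, subr0, addr0).
by move/eqP: vn0; apply; apply/rowP; apply: ord3P; rewrite mxE.
Qed.

(** At a singular point v of a conic n, the adjugate of the Hessian is a multiple
    of the rank one matrix of v; its contraction with the Hessian of p, which is
    the derivative of the determinant along p, is therefore a multiple of p(v).
    Here v = (1, Y, Z). *)
Lemma affine_singular_point (a b c d e f : K) p Y Z :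
  2 * a + b * Y + d * Z = 0 -> b + 2 * c * Y + e * Z = 0 ->
  d + e * Y + 2 * f * Z = 0 ->
  quad_det [:: a; b; c; d; e; f] = 0 /\
  quad_dpol [:: a; b; c; d; e; f] p = (4 * c * f - e ^+ 2) *
    (p`_0 + p`_1 * Y + p`_2 * Y ^+ 2 + p`_3 * Z + p`_4 * (Y * Z) + p`_5 * Z ^+ 2).
Proof.
move=> ea eb ed.
have bE : b = - (2 * c * Y + e * Z) by apply/eqP; rewrite -addr_eq0 addrA eb.
have dE : d = - (e * Y + 2 * f * Z) by apply/eqP; rewrite -addr_eq0 addrA ed.
have aE : a = - (b * Y + d * Z) / 2.
  transitivity ((2 * a + b * Y + d * Z - (b * Y + d * Z)) / 2).
    by field.
  by rewrite ea sub0r.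
rewrite /quad_det /quad_dpol /=; split; rewrite aE bE dE; by field.
Qed.

(** If the gradients of q and p at a common point v are proportional, the conic
    q - t p is singular at v, and t is a double root of the determinant of the
    pencil because p also passes through v. *)
Lemma singular_member q p (v : 'I_3 -> K) t : (exists i, v i != 0) ->
  (forall i, (quad q)^`M(i).@[v] = t * (quad p)^`M(i).@[v]) ->
  (quad p).@[v] = 0 ->
  let n := [seq q`_i - t * p`_i | i <- iota 0 6] in
  quad_det n = 0 /\ quad_dpol n p = 0.
Proof.
move=> vn0 grad pv /=.
move: (grad ix) (grad iy) (grad iz) pv; rewrite !quadE !meval_lin meval_quad.
set n0 := q`_0 - _; set n1 := q`_1 - _; set n2 := q`_2 - _.
set n3 := q`_3 - _; set n4 := q`_4 - _; set n5 := q`_5 - _.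
move=> gx gy gz pv.
have ex : 2 * n0 * v ix + n1 * v iy + n3 * v iz = 0.
  by move/eqP: gx; rewrite -subr_eq0 => /eqP gx; rewrite -[RHS]gx /n0 /n1 /n3; ring.
have ey : n1 * v ix + 2 * n2 * v iy + n4 * v iz = 0.
  by move/eqP: gy; rewrite -subr_eq0 => /eqP gy; rewrite -[RHS]gy /n1 /n2 /n4; ring.
have ez : n3 * v ix + n4 * v iy + 2 * n5 * v iz = 0.
  by move/eqP: gz; rewrite -subr_eq0 => /eqP gz; rewrite -[RHS]gz /n3 /n4 /n5; ring.
(* In each case the coordinates are permuted so that the nonzero one comes first. *)
case: vn0 => i; move: i ex ey ez pv {gx gy gz}; apply: ord3P;
  move: (v ix) (v iy) (v iz) => X Y Z ex ey ez pv nz.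
- pose p' := [:: p`_0; p`_1; p`_2; p`_3; p`_4; p`_5].
  have [||| d0 d1] := @affine_singular_point n0 n1 n2 n3 n4 n5 p' (Y / X) (Z / X).
  + by transitivity ((2 * n0 * X + n1 * Y + n3 * Z) / X); [field | rewrite ex mul0r].
  + by transitivity ((n1 * X + 2 * n2 * Y + n4 * Z) / X); [field | rewrite ey mul0r].
  + by transitivity ((n3 * X + n4 * Y + 2 * n5 * Z) / X); [field | rewrite ez mul0r].
  split; first by rewrite -d0 /quad_det /=; ring.
  transitivity (quad_dpol [:: n0; n1; n2; n3; n4; n5] p').
    by rewrite /quad_dpol /=; ring.
  rewrite d1 /=; set k := (4 * _ * _ - _).
  by rewrite -[RHS](mulr0 (k / X ^+ 2)) -[in RHS]pv; field.
- pose p' := [:: p`_2; p`_1; p`_0; p`_4; p`_3; p`_5].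
  have [||| d0 d1] := @affine_singular_point n2 n1 n0 n4 n3 n5 p' (X / Y) (Z / Y).
  + by transitivity ((n1 * X + 2 * n2 * Y + n4 * Z) / Y); [field | rewrite ey mul0r].
  + by transitivity ((2 * n0 * X + n1 * Y + n3 * Z) / Y); [field | rewrite ex mul0r].
  + by transitivity ((n3 * X + n4 * Y + 2 * n5 * Z) / Y); [field | rewrite ez mul0r].
  split; first by rewrite -d0 /quad_det /=; ring.
  transitivity (quad_dpol [:: n2; n1; n0; n4; n3; n5] p').
    by rewrite /quad_dpol /=; ring.
  rewrite d1 /=; set k := (4 * _ * _ - _).
  by rewrite -[RHS](mulr0 (k / Y ^+ 2)) -[in RHS]pv; field.
- pose p' := [:: p`_5; p`_4; p`_2; p`_3; p`_1; p`_0].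
  have [||| d0 d1] := @affine_singular_point n5 n4 n2 n3 n1 n0 p' (Y / Z) (X / Z).
  + by transitivity ((n3 * X + n4 * Y + 2 * n5 * Z) / Z); [field | rewrite ez mul0r].
  + by transitivity ((n1 * X + 2 * n2 * Y + n4 * Z) / Z); [field | rewrite ey mul0r].
  + by transitivity ((2 * n0 * X + n1 * Y + n3 * Z) / Z); [field | rewrite ex mul0r].
  split; first by rewrite -d0 /quad_det /=; ring.
  transitivity (quad_dpol [:: n5; n4; n2; n3; n1; n0] p').
    by rewrite /quad_dpol /=; ring.
  rewrite d1 /=; set k := (4 * _ * _ - _).
  by rewrite -[RHS](mulr0 (k / Z ^+ 2)) -[in RHS]pv; field.
Qed.

Lemma pencil_disc_not_tangent q p : quad_det p != 0 -> pencil_disc q p != 0 ->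
  ~ tangent (quad q) (quad p).
Proof.
move=> Dp Dqp [v [[vn0 _] pv tan]].
have [i gi] := quad_det_neq0_smooth Dp pv.
set f := fun j => (quad q)^`M(j).@[v ord0].
set g := fun j => (quad p)^`M(j).@[v ord0].
have fg j : f j = f i / g i * g j.
  case: (eqVneq j i) => [->|ji]; first by rewrite divfK.
  pose u : 'rV[K]_3 := \row_k (g i * (k == j)%:R - g j * (k == i)%:R).
  have dot (h : 'I_3 -> K) : \sum_k h k * u ord0 k = h j * g i - h i * g j.
    under eq_bigr do rewrite mxE mulrBr.
    rewrite sumrB (bigD1 j) //= big1 => [|k /negPf ->]; last by rewrite !mulr0.
    rewrite [X in _ - X](bigD1 i) //= big1 => [|k /negPf ->]; last by rewrite !mulr0.
    by rewrite !eqxx !addr0 !mulr1.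
  have : tangent_line (quad p) v u.
    by rewrite /tangent_line dot -/(g i) -/(g j) mulrC subrr.
  move/tan; rewrite /tangent_line dot -/(f i) -/(f j) => /eqP.
  rewrite subr_eq0 => /eqP e.
  by rewrite mulrAC -e mulfK.
have [|n0 n1] := @singular_member q p (v ord0) (f i / g i) _ fg (proj2 pv).
  apply/existsP; apply: contraNT vn0; rewrite negb_exists => /forallP v0.
  by apply/eqP/rowP => j; rewrite mxE; apply/eqP; have := v0 j; rewrite negbK.
move/eqP: Dqp; apply.
apply: (@cubic_disc_double_root _ _ _ _ (- (f i / g i))).
  by rewrite -n0 /quad_dpol /quad_det /=; ring.
by rewrite -n1 /quad_dpol /quad_det /=; ring.
Qed.

End Conics.

(** * Pullbacks of affine forms by a pair of conics *)

Section Pullback.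
Context {K : numFieldType}.
Local Notation x := ('X_ix : {mpoly K[3]}).
Local Notation y := ('X_iy : {mpoly K[3]}).
Local Notation z := ('X_iz : {mpoly K[3]}).
Implicit Types (u v q p : seq K) (w : V3 K).

Lemma quad_neq0 q : quad_det q != 0 -> quad q != 0.
Proof.
move=> /quad_det_neq0_smooth smooth; apply/eqP => q0.
have [|i] := smooth (delta_mx 0 ix); last by rewrite q0 mderiv0 meval0 eqxx.
split; last by rewrite q0 meval0.
by apply/eqP => /rowP /(_ ix)/eqP; rewrite !mxE eqxx oner_eq0.
Qed.

(** Nonzero exactly when both conics are smooth and transverse to the line at
    infinity, do not meet on that line, and the determinant of their pencil is a
    separable cubic. *)
Definition generic_pair q p : K :=
  quad_det q * quad_det p * disc_infinity q * disc_infinity p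
  * res_infinity q p * pencil_disc q p.

Lemma X22_generic_pair w q p : poincare w -> generic_pair q p != 0 ->
  (exists KF, is_cofactor w (quad q) KF) ->
  (exists KF, is_cofactor w (quad p) KF) -> X22 w.
Proof.
move=> Pw; rewrite /generic_pair !mulf_eq0 !negb_or -!andbA.
case/and5P=> Dq Dp Iq Ip /andP[Rqp Dqp] Kq Kp.
split=> //; exists (quad q), (quad p); split.
- split; (split; [split; [exact: quad_neq0 | exact: quad_homog]|]).
    exact: quad_det_neq0_smooth.
  exact: quad_det_neq0_smooth.
- split; split=> //; try exact: quad_neq0; exists 2%N; exact: quad_homog.
- split; exact: disc_infinity_not_tangent.
- exact: pencil_disc_not_tangent.
- exact: res_infinity_no_common_point.
Qed.

(** The affine function a + bU + cV of the two conics, homogenized. *)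
Definition affine_in u v (a b c : K) : {mpoly K[3]} :=
  a *: z ^+ 2 + b *: quad u + c *: quad v.

Lemma affine_in_homog u v a b c : affine_in u v a b c \is 2.-homog.
Proof. by rewrite !rpredD // rpredZ // ?quad_homog // expr2 homog2M // homogX1. Qed.

(** The coefficient of dx or dy in E dU + H dV, where E = e0 + e1 U + e2 V and
    H = h0 + h1 U + h2 V. *)
Definition pullcoef u v (e0 e1 e2 h0 h1 h2 : K) (i : 'I_3) :=
  affine_in u v e0 e1 e2 * (quad u)^`M(i) + affine_in u v h0 h1 h2 * (quad v)^`M(i).

Definition pullform u v (e0 e1 e2 h0 h1 h2 : K) : V3 K :=
  (indhomog 3 (pullcoef u v e0 e1 e2 h0 h1 h2 ix),
   indhomog 3 (pullcoef u v e0 e1 e2 h0 h1 h2 iy)).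

Lemma pullcoef_homog u v e0 e1 e2 h0 h1 h2 i :
  pullcoef u v e0 e1 e2 h0 h1 h2 i \is 3.-homog.
Proof.
have d1 q : (quad q)^`M(i) \is 1.-homog.
  by move: i; apply: ord3P; rewrite quadE lin_homog.
by rewrite rpredD // homog3M // affine_in_homog.
Qed.

Lemma formP_pull u v e0 e1 e2 h0 h1 h2 :
  formP (pullform u v e0 e1 e2 h0 h1 h2) = pullcoef u v e0 e1 e2 h0 h1 h2 ix.
Proof. by apply: insubdK; apply: pullcoef_homog. Qed.

Lemma formQ_pull u v e0 e1 e2 h0 h1 h2 :
  formQ (pullform u v e0 e1 e2 h0 h1 h2) = pullcoef u v e0 e1 e2 h0 h1 h2 iy.
Proof. by apply: insubdK; apply: pullcoef_homog. Qed.

Lemma eq_form w w' : formP w = formP w' -> formQ w = formQ w' -> w = w'.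
Proof.
by case: w w' => [a b] [a' b'] /= /val_inj eP /val_inj eQ; congr pair.
Qed.

Definition bracket u v : {mpoly K[3]} :=
  (quad u)^`M(ix) * (quad v)^`M(iy) - (quad u)^`M(iy) * (quad v)^`M(ix).

Lemma mderiv_affine_in u v a b c i : i != iz ->
  (affine_in u v a b c)^`M(i) = b *: (quad u)^`M(i) + c *: (quad v)^`M(i).
Proof.
move=> iz'; rewrite /affine_in; move: (quad u) (quad v) => U V.
rewrite !mderivD !mderivZ expr2 mderivM mderivXU eq_sym (negPf iz').
by rewrite raddf0 mul0r mulr0 addr0 scaler0 add0r.
Qed.

(** The hypotheses say that the line a + bU + cV is invariant by the affine form
    E dU + H dV: the wedge product of that form with its differential is k times
    the line times dU wedge dV. *)
Lemma pull_cofactor u v e0 e1 e2 h0 h1 h2 a b c k :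
  c * e0 - b * h0 = k * a -> c * e1 - b * h1 = k * b -> c * e2 - b * h2 = k * c ->
  is_cofactor (pullform u v e0 e1 e2 h0 h1 h2) (affine_in u v a b c)
    (- k *: bracket u v).
Proof.
move=> ka kb kc; split.
  by rewrite rpredZ // rpredB // homog2M // quadE lin_homog.
have kF : k *: affine_in u v a b c =
    c *: affine_in u v e0 e1 e2 - b *: affine_in u v h0 h1 h2.
  transitivity ((k * a) *: z ^+ 2 + (k * b) *: quad u + (k * c) *: quad v).
    by rewrite /affine_in -!mul_mpolyC; ring.
  by rewrite -ka -kb -kc /affine_in -!mul_mpolyC; ring.
rewrite scaleNr mulrN opprK -scalerAr scalerAl kF formP_pull formQ_pull /pullcoef.
rewrite !mderiv_affine_in // /bracket.
by rewrite -!mul_mpolyC; ring.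
Qed.

Let o : 'I_3 -> K := origin ord0.

Lemma meval_affine_in_origin u v a b c : u`_5 = 0 -> v`_5 = 0 ->
  (affine_in u v a b c).@[o] = a.
Proof.
move=> u5 v5; have q0 q : q`_5 = 0 -> (quad q).@[o] = 0.
  by move=> q5; rewrite meval_quad q5 /o !mxE /= !(mulr0, mul0r, expr2, addr0).
rewrite /affine_in !mevalD !mevalZ !q0 // !mulr0 !addr0 expr2 mevalM mevalXU.
by rewrite /o mxE /= !mulr1.
Qed.

Lemma meval_pullcoef_origin u v e0 e1 e2 h0 h1 h2 i : u`_5 = 0 -> v`_5 = 0 ->
  (pullcoef u v e0 e1 e2 h0 h1 h2 i).@[o] =
  e0 * (quad u)^`M(i).@[o] + h0 * (quad v)^`M(i).@[o].
Proof.
by move=> u5 v5; rewrite /pullcoef mevalD !mevalM !meval_affine_in_origin.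
Qed.

Lemma meval_mderiv_pullcoef_origin u v e0 e1 e2 h0 h1 h2 i j :
  u`_5 = 0 -> v`_5 = 0 -> j != iz ->
  (pullcoef u v e0 e1 e2 h0 h1 h2 i)^`M(j).@[o] =
  (e1 * (quad u)^`M(j).@[o] + e2 * (quad v)^`M(j).@[o]) * (quad u)^`M(i).@[o]
  + e0 * (quad u)^`M(i)^`M(j).@[o]
  + (h1 * (quad u)^`M(j).@[o] + h2 * (quad v)^`M(j).@[o]) * (quad v)^`M(i).@[o]
  + h0 * (quad v)^`M(i)^`M(j).@[o].
Proof.
move=> u5 v5 jz; rewrite /pullcoef mderivD !mderivM !mderiv_affine_in //.
move: (meval_affine_in_origin e0 e1 e2 u5 v5) (meval_affine_in_origin h0 h1 h2 u5 v5).
move: (affine_in u v e0 e1 e2) (affine_in u v h0 h1 h2) => E H Eo Ho.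
move: ((quad u)^`M(i)^`M(j)) ((quad v)^`M(i)^`M(j)) => Uij Vij.
move: ((quad u)^`M(i)) ((quad v)^`M(i)) => Ui Vi.
move: ((quad u)^`M(j)) ((quad v)^`M(j)) => Uj Vj.
by rewrite !(mevalD, mevalM, mevalZ) Eo Ho !addrA.
Qed.

Lemma mderiv_lin (a b c : K) (i : 'I_3) :
  (lin a b c)^`M(i) = ([:: a; b; c]`_i)%:MP.
Proof.
rewrite /lin !(mderivD, mderivZ) !mderivXU -!mul_mpolyC.
move: i; apply: ord3P; rewrite /= ?mpolyC0 ?mpolyC1; ring.
Qed.

(** When U and V vanish at the origin, the linear part of the pullback there
    only involves the constant terms of E and H paired with the Hessians of U and
    V, and the linear terms of E and H paired with the gradients. *)
Lemma poincare_pull u v e0 e1 e2 h0 h1 h2 : u`_5 = 0 -> v`_5 = 0 ->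
  poincare (pullform u v e0 e1 e2 h0 h1 h2) <->
  [/\ e0 * u`_3 + h0 * v`_3 = 0 /\ e0 * u`_4 + h0 * v`_4 = 0,
   (e1 * u`_3 + e2 * v`_3) * u`_3 + 2 * e0 * u`_0
     + (h1 * u`_3 + h2 * v`_3) * v`_3 + 2 * h0 * v`_0 = 1 /\
   (e1 * u`_4 + e2 * v`_4) * u`_4 + 2 * e0 * u`_2
     + (h1 * u`_4 + h2 * v`_4) * v`_4 + 2 * h0 * v`_2 = 1 &
   (e1 * u`_4 + e2 * v`_4) * u`_3 + e0 * u`_1
     + (h1 * u`_4 + h2 * v`_4) * v`_3 + h0 * v`_1 = 0 /\
   (e1 * u`_3 + e2 * v`_3) * u`_4 + e0 * u`_1
     + (h1 * u`_3 + h2 * v`_3) * v`_4 + h0 * v`_1 = 0].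
Proof.
move=> u5 v5; rewrite /poincare formP_pull formQ_pull -/o.
rewrite !meval_pullcoef_origin // !meval_mderiv_pullcoef_origin //.
rewrite !quadE !mderiv_lin !meval_lin !mevalC /o !mxE /=.
split=> -[[a b] [c d] [e f]]; split; split;
  by [apply: etrans _ a; ring | apply: etrans _ b; ring | apply: etrans _ c; ring
     | apply: etrans _ d; ring | apply: etrans _ e; ring | apply: etrans _ f; ring].
Qed.
End Pullback.

(** * Normal forms of centers *)

Section Families.
Context {K : numFieldType}.
Implicit Types (u v q p : seq K) (g h : K -> K).

Lemma polyfun_nth6 (g0 g1 g2 g3 g4 g5 : K -> K) :
  polyfun g0 -> polyfun g1 -> polyfun g2 -> polyfun g3 -> polyfun g4 -> polyfun g5 ->
  forall i, polyfun (fun s => [:: g0 s; g1 s; g2 s; g3 s; g4 s; g5 s]`_i).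
Proof.
move=> ? ? ? ? ? ? [|[|[|[|[|[|i]]]]]] //=.
by rewrite nth_nil; apply: polyfun_cst.
Qed.

Lemma polyfun_generic_pair (q p : K -> seq K) :
  (forall i, polyfun (fun s => (q s)`_i)) -> (forall i, polyfun (fun s => (p s)`_i)) ->
  polyfun (fun s => generic_pair (q s) (p s)).
Proof.
move=> qP pP.
have detP (r : K -> seq K) : (forall i, polyfun (fun s => (r s)`_i)) ->
    polyfun (fun s => quad_det (r s)).
  by move=> rP; rewrite /quad_det; polyfun_tac.
have dpolP (r r' : K -> seq K) : (forall i, polyfun (fun s => (r s)`_i)) ->
    (forall i, polyfun (fun s => (r' s)`_i)) ->
    polyfun (fun s => quad_dpol (r s) (r' s)).
  by move=> rP rP'; rewrite /quad_dpol; polyfun_tac.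
have [dq dp] := (detP q qP, detP p pP).
have [dqp dpq] := (dpolP q p qP pP, dpolP p q pP qP).
rewrite /generic_pair /pencil_disc /cubic_disc /res_infinity /disc_infinity.
by polyfun_tac.
Qed.

Lemma polyfam_quad (q : K -> seq K) : (forall i, polyfun (fun s => (q s)`_i)) ->
  polyfam (fun s => quad (q s)).
Proof.
by move=> qP; rewrite /quad -lock; repeat apply: polyfamD; apply: polyfam_scale.
Qed.

Lemma polyfam_dquad (q : K -> seq K) i : (forall i, polyfun (fun s => (q s)`_i)) ->
  polyfam (fun s => (quad (q s))^`M(i)).
Proof.
move=> qP; suff : polyfam (fun s => [:: lin (2 * (q s)`_0) (q s)`_1 (q s)`_3;
    lin (q s)`_1 (2 * (q s)`_2) (q s)`_4; lin (q s)`_3 (q s)`_4 (2 * (q s)`_5)]`_i).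
  move=> [r rE]; exists r => s; rewrite -rE.
  by move: i {rE}; apply: ord3P; rewrite quadE.
have linP (a b c : K -> K) : polyfun a -> polyfun b -> polyfun c ->
    polyfam (fun s => lin (a s) (b s) (c s)).
  by move=> *; rewrite /lin; repeat apply: polyfamD; apply: polyfam_scale.
by move: i; apply: ord3P; apply: linP => //; polyfun_tac.
Qed.

Lemma polyfam_pullform (u v : K -> seq K) (e0 e1 e2 h0 h1 h2 : K -> K) :
  (forall i, polyfun (fun s => (u s)`_i)) -> (forall i, polyfun (fun s => (v s)`_i)) ->
  polyfun e0 -> polyfun e1 -> polyfun e2 -> polyfun h0 -> polyfun h1 -> polyfun h2 ->
  let w s := pullform (u s) (v s) (e0 s) (e1 s) (e2 s) (h0 s) (h1 s) (h2 s) in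
  polyfam (fun s => formP (w s)) /\ polyfam (fun s => formQ (w s)).
Proof.
move=> uP vP ? ? ? ? ? ?.
have affP (a b c : K -> K) : polyfun a -> polyfun b -> polyfun c ->
    polyfam (fun s => affine_in (u s) (v s) (a s) (b s) (c s)).
  move=> aP bP cP; rewrite /affine_in.
  have scaleP (f : K -> K) (F : K -> {mpoly K[3]}) : polyfun f -> polyfam F ->
      polyfam (fun s => f s *: F s).
    move=> fP FP; have [r rE] := polyfamM (polyfam_scale 1 fP) FP.
    by exists r => s; rewrite -rE -scalerAl mul1r.
  apply: polyfamD; first apply: polyfamD.
  - exact: polyfam_scale.
  - by apply: scaleP => //; apply: polyfam_quad.
  - by apply: scaleP => //; apply: polyfam_quad.
have coefP i : polyfam (fun s =>
    pullcoef (u s) (v s) (e0 s) (e1 s) (e2 s) (h0 s) (h1 s) (h2 s) i).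
  rewrite /pullcoef; apply: polyfamD; apply: polyfamM;
    by [apply: affP | apply: polyfam_dquad].
by split; [have [r rE] := coefP ix | have [r rE] := coefP iy]; exists r => s;
  rewrite ?formP_pull ?formQ_pull -rE.
Qed.

Lemma pullform_closure (S : V3 K -> Prop) (u v : K -> seq K)
    (e0 e1 e2 h0 h1 h2 D : K -> K) s0 s1 :
  (forall i, polyfun (fun s => (u s)`_i)) -> (forall i, polyfun (fun s => (v s)`_i)) ->
  polyfun e0 -> polyfun e1 -> polyfun e2 -> polyfun h0 -> polyfun h1 -> polyfun h2 ->
  polyfun D -> D s1 != 0 ->
  let w s := pullform (u s) (v s) (e0 s) (e1 s) (e2 s) (h0 s) (h1 s) (h2 s) in
  (forall s, D s != 0 -> zariski_closure S (w s)) -> zariski_closure S (w s0).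
Proof.
move=> uP vP P0 P1 P2 P3 P4 P5 DP Ds1 w wS.
have [wP wQ] := polyfam_pullform uP vP P0 P1 P2 P3 P4 P5.
exact: zariski_closure_curve wP wQ DP Ds1 wS.
Qed.

End Families.

Section Normal.
Context {K : numClosedFieldType}.
Implicit Types (u v q p : seq K).

Lemma closure_sub (S : V3 K -> Prop) w : S w -> zariski_closure S w.
Proof. by move=> Sw Z _; apply. Qed.

(** The two factors F, G of an integral FG/2 with quadratic part (x^2 + y^2)/2:
    their linear parts are x + iy and x - iy. *)
Definition factor_plus (f0 f1 f2 : K) : seq K := [:: f0; f1; f2; 1; 'i; 0].
Definition factor_minus (g0 g1 g2 : K) : seq K := [:: g0; g1; g2; 1; - 'i; 0].
Definition hamiltonian_form f0 f1 f2 g0 g1 g2 : V3 K :=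
  pullform (factor_plus f0 f1 f2) (factor_minus g0 g1 g2) 0 0 (1 / 2) 0 (1 / 2) 0.

Lemma poincare_hamiltonian_form f0 f1 f2 g0 g1 g2 :
  poincare (hamiltonian_form f0 f1 f2 g0 g1 g2).
Proof.
apply/poincare_pull => //=.
have i2 : 'i ^+ 2 = -1 :> K := sqrCi _.
split; split; try by ring.
- by field.
- by field: i2.
Qed.

Lemma hamiltonian_form_X22 f0 f1 f2 g0 g1 g2 :
  generic_pair (factor_plus f0 f1 f2) (factor_minus g0 g1 g2) != 0 ->
  X22 (hamiltonian_form f0 f1 f2 g0 g1 g2).
Proof.
set u := factor_plus _ _ _; set v := factor_minus _ _ _ => gen.
have cofactor := @pull_cofactor K u v 0 0 (1 / 2) 0 (1 / 2) 0.
apply: X22_generic_pair gen _ _; first exact: poincare_hamiltonian_form.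
- have := cofactor 0 1 0 (- (1 / 2)); rewrite /affine_in !scale0r scale1r add0r addr0.
  by move=> cof; eexists; apply: cof; ring.
- have := cofactor 0 0 1 (1 / 2); rewrite /affine_in !scale0r scale1r !add0r.
  by move=> cof; eexists; apply: cof; ring.
Qed.

(** The target of the line is the pair F = -2x^2 + y^2 + (x + iy)z,
    G = x^2 - y^2 + (x - iy)z. *)
Lemma hamiltonian_form_closure f0 f1 f2 g0 g1 g2 :
  zariski_closure X22 (hamiltonian_form f0 f1 f2 g0 g1 g2).
Proof.
pose line (a b : K) s := a + s * (b - a).
have lineP a b : polyfun (line a b) by rewrite /line; polyfun_tac.
have line0 a b : line a b 0 = a by rewrite /line mul0r addr0.
have line1 a b : line a b 1 = b by rewrite /line mul1r addrC subrK.
pose U s := factor_plus (line f0 (-2) s) (line f1 0 s) (line f2 1 s).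
pose V s := factor_minus (line g0 1 s) (line g1 0 s) (line g2 (-1) s).
have UP i : polyfun (fun s => (U s)`_i) by apply: polyfun_nth6; polyfun_tac.
have VP i : polyfun (fun s => (V s)`_i) by apply: polyfun_nth6; polyfun_tac.
have := @pullform_closure K X22 U V (fun=> 0) (fun=> 0) (fun=> 1 / 2) (fun=> 0)
  (fun=> 1 / 2) (fun=> 0) (fun s => generic_pair (U s) (V s)) 0 1 UP VP.
rewrite /= /U /V !line0 !line1; apply; try exact: polyfun_cst.
- exact: polyfun_generic_pair.
- have i2 : 'i ^+ 2 = -1 :> K := sqrCi _.
  (* The nonzero number is the value of [generic_pair] at the end point. *)
  have : (2 ^+ 10 * 69 : K) != 0 by rewrite mulf_neq0 ?expf_neq0 ?pnatr_eq0.
  apply: contra_neq => <-.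
  rewrite /generic_pair /pencil_disc /cubic_disc /res_infinity /disc_infinity.
  by rewrite /quad_dpol /quad_det /=; ring: i2.
- by move=> s /hamiltonian_form_X22/closure_sub.
Qed.

Definition lincomb (r s : K) u v : seq K := [seq r * u`_i + s * v`_i | i <- iota 0 6].

Lemma quad_lincomb r s u v : quad (lincomb r s u v) = r *: quad u + s *: quad v.
Proof. by rewrite /quad -lock /lincomb /= -!mul_mpolyC; ring. Qed.

Lemma mderiv_quad_lincomb r s u v i :
  (quad (lincomb r s u v))^`M(i) = r *: (quad u)^`M(i) + s *: (quad v)^`M(i).
Proof.
by rewrite quad_lincomb; move: (quad u) (quad v) => U V; rewrite mderivD !mderivZ.
Qed.

Lemma pullform_swap u v e0 e1 e2 h0 h1 h2 :
  pullform u v e0 e1 e2 h0 h1 h2 = pullform v u h0 h2 h1 e0 e2 e1.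
Proof.
by apply: eq_form; rewrite ?formP_pull ?formQ_pull /pullcoef /affine_in
  -!mul_mpolyC; ring.
Qed.

(** Linear changes of the pair (U, V) act on the six coefficients of the affine
    form as pullbacks by linear maps of the plane. *)
Lemma pullform_lincomb u v r s r' s' e0 e1 e2 h0 h1 h2 :
  pullform (lincomb r s u v) (lincomb r' s' u v) e0 e1 e2 h0 h1 h2 =
  pullform u v
    (e0 * r + h0 * r')
    ((e1 * r + e2 * r') * r + (h1 * r + h2 * r') * r')
    ((e1 * s + e2 * s') * r + (h1 * s + h2 * s') * r')
    (e0 * s + h0 * s')
    ((e1 * r + e2 * r') * s + (h1 * r + h2 * r') * s')
    ((e1 * s + e2 * s') * s + (h1 * s + h2 * s') * s').
Proof.
suff coefE i : pullcoef (lincomb r s u v) (lincomb r' s' u v) e0 e1 e2 h0 h1 h2 i =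
  pullcoef u v (e0 * r + h0 * r')
    ((e1 * r + e2 * r') * r + (h1 * r + h2 * r') * r')
    ((e1 * s + e2 * s') * r + (h1 * s + h2 * s') * r') (e0 * s + h0 * s')
    ((e1 * r + e2 * r') * s + (h1 * r + h2 * r') * s')
    ((e1 * s + e2 * s') * s + (h1 * s + h2 * s') * s') i.
  by apply: eq_form; rewrite ?formP_pull ?formQ_pull coefE.
rewrite /pullcoef /affine_in !mderiv_quad_lincomb !quad_lincomb.
move: ((quad u)^`M(i)) ((quad v)^`M(i)) (quad u) (quad v) => Ui Vi U V.
rewrite -!mul_mpolyC; ring.
Qed.

(** Translating (U, V) so that both conics pass through the origin only changes the
    constant terms of E and H. *)
Lemma pullform_shift u v e0 e1 e2 h0 h1 h2 :
  pullform u v e0 e1 e2 h0 h1 h2 =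
  pullform (take 5 u) (take 5 v) (e0 + e1 * u`_5 + e2 * v`_5) e1 e2
                                 (h0 + h1 * u`_5 + h2 * v`_5) h1 h2.
Proof.
have quadT q : quad q = quad (take 5 q) + q`_5 *: 'X_iz ^+ 2.
  have t5 : (take 5 q)`_5 = 0 by rewrite nth_default // size_take_min geq_minl.
  by rewrite /quad -lock t5 !nth_take // scale0r addr0.
have dquadT q i : i != iz -> (quad q)^`M(i) = (quad (take 5 q))^`M(i).
  by move: i; apply: ord3P => // _; rewrite !quadE !nth_take.
by apply: eq_form; rewrite ?formP_pull ?formQ_pull /pullcoef /affine_in
  ?(dquadT u) ?(dquadT v) // ?(quadT u) ?(quadT v) -!mul_mpolyC; ring.
Qed.

Lemma eq_pullform u v u' v' e0 e1 e2 h0 h1 h2 :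
  (forall i, (i < 6)%N -> u`_i = u'`_i) -> (forall i, (i < 6)%N -> v`_i = v'`_i) ->
  pullform u v e0 e1 e2 h0 h1 h2 = pullform u' v' e0 e1 e2 h0 h1 h2.
Proof.
have eqq q q' : (forall i, (i < 6)%N -> q`_i = q'`_i) -> quad q = quad q'.
  by move=> E; rewrite /quad -lock !E.
by move=> /eqq Eu /eqq Ev; rewrite /pullform /pullcoef /affine_in Eu Ev.
Qed.

Lemma eq_pullform_coef u v e0 e1 e2 h0 h1 h2 e0' e1' e2' h0' h1' h2' :
  e0 = e0' -> e1 = e1' -> e2 = e2' -> h0 = h0' -> h1 = h1' -> h2 = h2' ->
  pullform u v e0 e1 e2 h0 h1 h2 = pullform u v e0' e1' e2' h0' h1' h2'.
Proof. by move=> -> -> -> -> -> ->. Qed.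

(** Since V has linear part l1 x + l2 y, the term d V dV contributes d times the
    square of this linear part to the Hessian at the origin; the quadratic form U
    compensates for it, whatever the other parameters are. *)
Definition center_u (d l1 l2 : K) : seq K :=
  [:: (1 - d * l1 ^+ 2) / 2; - (d * l1 * l2); (1 - d * l2 ^+ 2) / 2; 0; 0; 0].
Definition center_v (l1 l2 v0 v1 v2 : K) : seq K := [:: v0; v1; v2; l1; l2; 0].
Definition center_form (a b c d l1 l2 v0 v1 v2 : K) : V3 K :=
  pullform (center_u d l1 l2) (center_v l1 l2 v0 v1 v2) 1 a b 0 c d.

Lemma poincare_center_form (a b c d l1 l2 v0 v1 v2 : K) :
  poincare (center_form a b c d l1 l2 v0 v1 v2).
Proof. by apply/poincare_pull => //=; split; split; field. Qed.

(** The conic 1 + tV - t^2 U, for d = 1. *)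
Definition eigen_conic (t l1 l2 v0 v1 v2 : K) : seq K :=
  [:: t * v0 - t ^+ 2 * ((1 - l1 ^+ 2) / 2); t * v1 + t ^+ 2 * (l1 * l2);
      t * v2 - t ^+ 2 * ((1 - l2 ^+ 2) / 2); t * l1; t * l2; 1].

(** For d = 1 and b = 0, the line 1 + rU + tV with t nonzero is invariant exactly when
    t is a root of t^2 + ct + a and r = - t^2; hence the parametrization by the two roots,
    which keeps the family polynomial. *)
Definition diagonal_form (t1 t2 l1 l2 v0 v1 v2 : K) : V3 K :=
  center_form (t1 * t2) 0 (- (t1 + t2)) 1 l1 l2 v0 v1 v2.

Lemma eigen_conic_cofactor (t1 t2 l1 l2 v0 v1 v2 t : K) : t = t1 \/ t = t2 ->
  exists KF, is_cofactor (diagonal_form t1 t2 l1 l2 v0 v1 v2)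
                         (quad (eigen_conic t l1 l2 v0 v1 v2)) KF.
Proof.
set u := center_u 1 l1 l2; set v := center_v l1 l2 v0 v1 v2 => tE.
have <- : affine_in u v 1 (- t ^+ 2) t = quad (eigen_conic t l1 l2 v0 v1 v2).
  by rewrite /affine_in /quad -lock /= -!mul_mpolyC; ring.
by eexists; apply: (@pull_cofactor K u v _ _ _ _ _ _ _ _ _ t); case: tE => ->; ring.
Qed.

(** The target of the line is t1 = 1, t2 = 2, with linear part x + y and quadratic
    part x^2 - xy + y^2 of V. *)
Lemma diagonal_form_closure (t1 t2 l1 l2 v0 v1 v2 : K) :
  zariski_closure X22 (diagonal_form t1 t2 l1 l2 v0 v1 v2).
Proof.
pose line (a b : K) s := a + s * (b - a).
have lineP a b : polyfun (line a b) by rewrite /line; polyfun_tac.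
have line0 a b : line a b 0 = a by rewrite /line mul0r addr0.
have line1 a b : line a b 1 = b by rewrite /line mul1r addrC subrK.
pose T1 := line t1 1; pose T2 := line t2 2; pose L1 := line l1 1; pose L2 := line l2 1.
pose W0 := line v0 1; pose W1 := line v1 (-1); pose W2 := line v2 1.
pose F s := eigen_conic (T1 s) (L1 s) (L2 s) (W0 s) (W1 s) (W2 s).
pose G s := eigen_conic (T2 s) (L1 s) (L2 s) (W0 s) (W1 s) (W2 s).
have FP i : polyfun (fun s => (F s)`_i) by apply: polyfun_nth6; polyfun_tac.
have GP i : polyfun (fun s => (G s)`_i) by apply: polyfun_nth6; polyfun_tac.
pose U s := center_u 1 (L1 s) (L2 s).
pose V s := center_v (L1 s) (L2 s) (W0 s) (W1 s) (W2 s).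
have UP i : polyfun (fun s => (U s)`_i) by apply: polyfun_nth6; polyfun_tac.
have VP i : polyfun (fun s => (V s)`_i) by apply: polyfun_nth6; polyfun_tac.
have prodP : polyfun (fun s => T1 s * T2 s) by polyfun_tac.
have sumP : polyfun (fun s => - (T1 s + T2 s)) by polyfun_tac.
have := @pullform_closure K X22 U V _ _ _ _ _ _ (fun s => generic_pair (F s) (G s)) 0 1
  UP VP (polyfun_cst 1) prodP (polyfun_cst 0) (polyfun_cst 0) sumP (polyfun_cst 1)
  (polyfun_generic_pair FP GP).
rewrite /F /G /U /V /T1 /T2 /L1 /L2 /W0 /W1 /W2 !line0 !line1; apply.
(* The nonzero number is the value of [generic_pair] at the end point. *)
- have : (2 ^+ 16 * 3 : K) != 0 by rewrite mulf_neq0 ?expf_neq0 ?pnatr_eq0.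
  apply: contra_neq => <-.
  rewrite /generic_pair /pencil_disc /cubic_disc /res_infinity /disc_infinity.
  by rewrite /quad_dpol /quad_det /=; field.
move=> s gen; apply: closure_sub; apply: X22_generic_pair gen _ _.
- exact: poincare_center_form.
- by apply: eigen_conic_cofactor; left.
- by apply: eigen_conic_cofactor; right.
Qed.

Lemma sum_prod_exists (s p : K) : exists a b, a + b = s /\ a * b = p.
Proof.
pose r := sqrtC (s ^+ 2 - 4 * p).
have r2 : r ^+ 2 = s ^+ 2 - 4 * p by rewrite sqrtCK.
exists ((s + r) / 2), ((s - r) / 2); split; first by field.
by field: r2.
Qed.

(** Forms with d nonzero are dense in the family, and become diagonal after
    replacing V by sqrt(d) V + (b / sqrt(d)) U. *)
Lemma center_form_closure (a b c d l1 l2 v0 v1 v2 : K) :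
  zariski_closure X22 (center_form a b c d l1 l2 v0 v1 v2).
Proof.
suff nz d' : d' != 0 -> zariski_closure X22 (center_form a b c d' l1 l2 v0 v1 v2).
  have UP i : polyfun (fun s => (center_u s l1 l2)`_i).
    by apply: polyfun_nth6; polyfun_tac.
  have VP i : polyfun (fun=> (center_v l1 l2 v0 v1 v2)`_i) by apply: polyfun_cst.
  exact: (@pullform_closure K X22 _ _ _ _ _ _ _ _ _ d 1 UP VP (polyfun_cst 1)
    (polyfun_cst a) (polyfun_cst b) (polyfun_cst 0) (polyfun_cst c)
    polyfun_id polyfun_id (oner_neq0 K) nz).
move=> d'0; pose dl := sqrtC d'.
have dlE : dl ^+ 2 = d' by rewrite sqrtCK.
have dl0 : dl != 0 by rewrite sqrtC_eq0.
have [s1 [s2 [sumE prodE]]] := sum_prod_exists (- ((c - b) / dl)) (a - b * c / dl ^+ 2).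
have -> : center_form a b c d' l1 l2 v0 v1 v2 =
  diagonal_form s1 s2 (dl * l1) (dl * l2)
    (dl * v0 + b / dl * ((1 - d' * l1 ^+ 2) / 2))
    (dl * v1 - b / dl * (d' * l1 * l2))
    (dl * v2 + b / dl * ((1 - d' * l2 ^+ 2) / 2)).
  rewrite /diagonal_form sumE prodE opprK.
  set u := center_u d' l1 l2; set v := center_v l1 l2 v0 v1 v2.
  transitivity (pullform (lincomb 1 0 u v) (lincomb (b / dl) dl u v)
     1 (a - b * c / dl ^+ 2) 0 0 ((c - b) / dl) 1).
    rewrite pullform_lincomb.
    apply: eq_pullform_coef.
    all: rewrite -?dlE.
    - by ring.
    - by field.
    - by field.
    - by ring.
    - by field.
    - by ring.
  by apply: eq_pullform; do 6?[case] => //= _; rewrite -?dlE; ring.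
exact: diagonal_form_closure.
Qed.

End Normal.

(** * Reduction of a center to its normal form *)

Section Reduction.
Context {K : numClosedFieldType}.
Implicit Types (u v : seq K).

(** The Poincare conditions force the linear parts of U and V to be independent and
    make E dU + H dV the differential of the quadratic form in U, V whose value on
    the linear parts is (x^2 + y^2)/2. Factoring x^2 + y^2 factors this quadratic
    form. *)
Lemma regular_center_closure u v e1 e2 h1 h2 : u`_5 = 0 -> v`_5 = 0 ->
  poincare (pullform u v 0 e1 e2 0 h1 h2) ->
  zariski_closure X22 (pullform u v 0 e1 e2 0 h1 h2).
Proof.
move=> u5 v5 /(poincare_pull _ _ _ _ _ _ u5 v5).
rewrite !(mulr0, mul0r, addr0) => -[_ []].
set jxx := (X in X = 1) => Jxx; set jyy := (X in X = 1) => Jyy [].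
set jxy := (X in X = 0) => Jxy; set jyx := (X in X = 0) => Jyx.
pose D := u`_3 * v`_4 - u`_4 * v`_3.
have D2 : D ^+ 2 * (e1 * h2 - e2 * h1) = 1.
  transitivity (jxx * jyy - jxy * jyx).
    by rewrite /D /jxx /jyy /jxy /jyx; ring.
  by rewrite Jxx Jyy Jxy Jyx; ring.
have D0 : D != 0.
  apply/eqP => D0; move: D2; rewrite D0 expr0n mul0r => /eqP.
  by rewrite eq_sym oner_eq0.
have i2 : 'i ^+ 2 = -1 :> K := sqrCi _.
(* The matrix (e1 e2; h1 h2) is the inverse of the Gram matrix of the linear
   parts of U and V, the Jacobian matrix at the origin being the identity. *)
have e1D : e1 * D ^+ 2 = v`_4 ^+ 2 + v`_3 ^+ 2.
  transitivity (v`_4 ^+ 2 * jxx + v`_3 ^+ 2 * jyy + (- (v`_3 * v`_4)) * jxy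
                + (- (v`_3 * v`_4)) * jyx).
    by rewrite /D /jxx /jyy /jxy /jyx; ring.
  by rewrite Jxx Jyy Jxy Jyx; ring.
have e2D : e2 * D ^+ 2 = - (u`_3 * v`_3 + u`_4 * v`_4).
  transitivity ((- (u`_4 * v`_4)) * jxx + (- (u`_3 * v`_3)) * jyy + (u`_3 * v`_4) * jxy
                + (u`_4 * v`_3) * jyx).
    by rewrite /D /jxx /jyy /jxy /jyx; ring.
  by rewrite Jxx Jyy Jxy Jyx; ring.
have h1D : h1 * D ^+ 2 = - (u`_3 * v`_3 + u`_4 * v`_4).
  transitivity ((- (u`_4 * v`_4)) * jxx + (- (u`_3 * v`_3)) * jyy + (u`_4 * v`_3) * jxy
                + (u`_3 * v`_4) * jyx).
    by rewrite /D /jxx /jyy /jxy /jyx; ring.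
  by rewrite Jxx Jyy Jxy Jyx; ring.
have h2D : h2 * D ^+ 2 = u`_4 ^+ 2 + u`_3 ^+ 2.
  transitivity (u`_4 ^+ 2 * jxx + u`_3 ^+ 2 * jyy + (- (u`_3 * u`_4)) * jxy
                + (- (u`_3 * u`_4)) * jyx).
    by rewrite /D /jxx /jyy /jxy /jyx; ring.
  by rewrite Jxx Jyy Jxy Jyx; ring.
have D2n0 : D ^+ 2 != 0 by rewrite expf_neq0.
have e1E : e1 = (v`_4 ^+ 2 + v`_3 ^+ 2) / D ^+ 2 by rewrite -e1D mulfK.
have e2E : e2 = - (u`_3 * v`_3 + u`_4 * v`_4) / D ^+ 2 by rewrite -e2D mulfK.
have h1E : h1 = - (u`_3 * v`_3 + u`_4 * v`_4) / D ^+ 2 by rewrite -h1D mulfK.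
have h2E : h2 = (u`_4 ^+ 2 + u`_3 ^+ 2) / D ^+ 2 by rewrite -h2D mulfK.
pose r := (v`_4 - 'i * v`_3) / D; pose s := ('i * u`_3 - u`_4) / D.
pose r' := (v`_4 + 'i * v`_3) / D; pose s' := - ('i * u`_3 + u`_4) / D.
pose f := lincomb r s u v; pose g := lincomb r' s' u v.
have -> : pullform u v 0 e1 e2 0 h1 h2 =
          hamiltonian_form f`_0 f`_1 f`_2 g`_0 g`_1 g`_2.
  transitivity (pullform f g 0 0 (1 / 2) 0 (1 / 2) 0).
    rewrite pullform_lincomb e1E e2E h1E h2E /r /s /r' /s'.
    by apply: eq_pullform_coef; field: i2.
  apply: eq_pullform; do 6?[case] => //= _; rewrite ?u5 ?v5 /r /s /r' /s'.
  - by rewrite /D; field.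
  - by rewrite /D; field.
  - by ring.
  - by rewrite /D; field.
  - by rewrite /D; field.
  - by ring.
exact: hamiltonian_form_closure.
Qed.

(** As the form vanishes at the origin, the constant terms e0, h0 of E and H give a
    combination e0 U + h0 V without linear part. In the pair formed by this
    combination and V, the constant term of the affine form is dU. *)
Lemma singular_center_closure u v e0 e1 e2 h0 h1 h2 :
  u`_5 = 0 -> v`_5 = 0 -> e0 != 0 ->
  poincare (pullform u v e0 e1 e2 h0 h1 h2) ->
  zariski_closure X22 (pullform u v e0 e1 e2 h0 h1 h2).
Proof.
move=> u5 v5 e0n0; pose U := lincomb e0 h0 u v.
(* The coefficients of the affine form after substituting U = (U' - h0 V) / e0,
   where U' = e0 U + h0 V. *)
pose a := e1 / e0 ^+ 2; pose b := e2 / e0 - h0 * a.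
pose c := h1 / e0 - h0 * a; pose d := h2 - h0 * c - h0 * (b + h0 * a).
have -> : pullform u v e0 e1 e2 h0 h1 h2 = pullform U v 1 a b 0 c d.
  transitivity (pullform U (lincomb 0 1 u v) 1 a b 0 c d).
    rewrite pullform_lincomb /d /c /b /a.
    by apply: eq_pullform_coef; field.
  by apply: eq_pullform => //; do 6?[case] => //= _; ring.
move=> Pw; have U5 : U`_5 = 0 by rewrite /= u5 v5; ring.
case/(poincare_pull _ _ _ _ _ _ U5 v5): (Pw) => -[U3 U4].
rewrite !mul0r !addr0 !mul1r in U3 U4; rewrite U3 U4 => -[Jxx Jyy] [Jxy _].
have U0E : U`_0 = (1 - d * v`_3 ^+ 2) / 2 by rewrite -[X in X - _]Jxx; field.
have U1E : U`_1 = - (d * v`_3 * v`_4) by rewrite -[RHS]addr0 -[X in _ = _ + X]Jxy; ring.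
have U2E : U`_2 = (1 - d * v`_4 ^+ 2) / 2 by rewrite -[X in X - _]Jyy; field.
have -> : pullform U v 1 a b 0 c d = center_form a b c d v`_3 v`_4 v`_0 v`_1 v`_2.
  by apply: eq_pullform; do 6?[case] => // _; rewrite ?U0E ?U1E ?U2E ?U3 ?U4 ?U5 ?v5.
exact: center_form_closure.
Qed.

Lemma poincare_pullform_closure u v e0 e1 e2 h0 h1 h2 :
  poincare (pullform u v e0 e1 e2 h0 h1 h2) ->
  zariski_closure X22 (pullform u v e0 e1 e2 h0 h1 h2).
Proof.
rewrite pullform_shift; move: (e0 + _ + _) (h0 + _ + _) => {e0 h0} e0 h0.
have t5 q : (take 5 q)`_5 = 0 :> K by rewrite nth_default // size_take_min geq_minl.
move: (take 5 u) (take 5 v) (t5 u) (t5 v) => {u v t5} u v u5 v5.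
case: (eqVneq e0 0) => [->|]; last exact: singular_center_closure.
case: (eqVneq h0 0) => [->|]; first exact: regular_center_closure.
by rewrite pullform_swap; apply: singular_center_closure.
Qed.

End Reduction.

(** * Forms of the family as pullbacks *)

Section CR5.
Context {K : numFieldType}.

(** The coefficients of the product of two linear forms: in affine coordinates, xy
    and x(x+y+c) become products of two lines. *)
Definition line_pair (a b : K * K * K) : seq K :=
  let: (a1, a2, a3) := a in let: (b1, b2, b3) := b in
  [:: a1 * b1; a1 * b2 + a2 * b1; a2 * b2; a1 * b3 + a3 * b1; a2 * b3 + a3 * b2;
      a3 * b3].

Lemma quad_line_pair a1 a2 a3 b1 b2 b3 :
  quad (line_pair (a1, a2, a3) (b1, b2, b3)) = lin a1 a2 a3 * lin b1 b2 b3.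
Proof. by rewrite /quad -lock /lin /= -!mul_mpolyC; ring. Qed.

Local Notation x := ('X_ord0 : {mpoly K[2]}).
Local Notation y := ('X_ord_max : {mpoly K[2]}).

Definition dlin (a b c : K) : {mpoly K[2]} := a *: x + b *: y + c%:MP.

Lemma dehomogenizeX i : dehomogenize 'X_i = [:: x; y; 1]`_i.
Proof. by rewrite /dehomogenize comp_mpolyXU. Qed.

Lemma dehomogenize_lin a b c : dehomogenize (lin a b c) = dlin a b c.
Proof.
rewrite /lin /dehomogenize !comp_mpolyD !comp_mpolyZ -!/(dehomogenize _).
by rewrite !dehomogenizeX /= alg_mpolyC.
Qed.

Lemma dehomogenizeM (F G : {mpoly K[3]}) :
  dehomogenize (F * G) = dehomogenize F * dehomogenize G.
Proof. by rewrite /dehomogenize rmorphM. Qed.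

Lemma dehomogenizeD (F G : {mpoly K[3]}) :
  dehomogenize (F + G) = dehomogenize F + dehomogenize G.
Proof. by rewrite /dehomogenize rmorphD. Qed.

Lemma dehomogenizeZ (a : K) (F : {mpoly K[3]}) :
  dehomogenize (a *: F) = a *: dehomogenize F.
Proof. by rewrite /dehomogenize comp_mpolyZ. Qed.

Lemma mderiv_line_pair a1 a2 a3 b1 b2 b3 i :
  (quad (line_pair (a1, a2, a3) (b1, b2, b3)))^`M(i) =
  ([:: a1; a2; a3]`_i)%:MP * lin b1 b2 b3 + lin a1 a2 a3 * ([:: b1; b2; b3]`_i)%:MP.
Proof. by rewrite quad_line_pair mderivM !mderiv_lin. Qed.

Lemma dehomogenizeC (a : K) : dehomogenize a%:MP = a%:MP.
Proof. by rewrite /dehomogenize comp_mpolyC. Qed.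

Lemma form_of_pullform (PQ : {mpoly K[2]} * {mpoly K[2]}) u v (e0 e1 e2 h0 h1 h2 : K) :
  PQ.1 = dehomogenize (pullcoef u v e0 e1 e2 h0 h1 h2 ix) ->
  PQ.2 = dehomogenize (pullcoef u v e0 e1 e2 h0 h1 h2 iy) ->
  form_of PQ = pullform u v e0 e1 e2 h0 h1 h2.
Proof.
case: PQ => P Q /= -> ->; apply: eq_form.
  by rewrite formP_pull /formP /= dehomogenizeK // pullcoef_homog.
by rewrite formQ_pull /formQ /= dehomogenizeK // pullcoef_homog.
Qed.

(** With U = xy and V = x(x+y+c), the form is
    - (l + kU + mV) dU + (- p + (m - n) U - qV) dV. *)
Lemma form_of_affine_pullback (A : 'M[K]_2) (t : 'cV[K]_2) (c k l m n p q : K) :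
  let a1 := A ord0 ord0 in let a2 := A ord0 ord_max in let a3 := t ord0 ord0 in
  let b1 := A ord_max ord0 in let b2 := A ord_max ord_max in
  let b3 := t ord_max ord0 in
  form_of (affine_pullback A t (CR5_form c k l m n p q)) =
  pullform (line_pair (a1, a2, a3) (b1, b2, b3))
    (line_pair (a1, a2, a3) (a1 + b1, a2 + b2, a3 + b3 + c))
    (- l) (- k) (- m) (- p) (m - n) (- q).
Proof.
move=> a1 a2 a3 b1 b2 b3.
set u := line_pair _ _; set v := line_pair _ _.
suff [eP eQ] : (affine_pullback A t (CR5_form c k l m n p q)).1 =
    dehomogenize (pullcoef u v (- l) (- k) (- m) (- p) (m - n) (- q) ix) /\
   (affine_pullback A t (CR5_form c k l m n p q)).2 =
    dehomogenize (pullcoef u v (- l) (- k) (- m) (- p) (m - n) (- q) iy).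
  exact: form_of_pullform.
rewrite /pullcoef /affine_in /u /v !mderiv_line_pair !quad_line_pair.
move: (dehomogenize_lin a1 a2 a3) (dehomogenize_lin b1 b2 b3).
move: (dehomogenize_lin (a1 + b1) (a2 + b2) (a3 + b3 + c)).
move: (lin a1 a2 a3) (lin b1 b2 b3) (lin (a1 + b1) (a2 + b2) (a3 + b3 + c)).
move=> L M N NE LE ME.
rewrite expr2 !(dehomogenizeD, dehomogenizeM, dehomogenizeZ, dehomogenizeC).
rewrite NE LE ME dehomogenizeX /= !mulr1 {L M N NE LE ME}.
rewrite /affine_pullback /=; set phi := [tuple _ | _ < 2].
have phiE (i : 'I_2) : phi`_i = dlin (A i ord0) (A i ord_max) (t i ord0).
  rewrite -tnth_nth tnth_mktuple big_ord_recr big_ord1 /dlin.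
  by congr (A _ _ *: 'X_ _ + _ + _); apply: val_inj.
have phi0 : phi`_0 = dlin a1 a2 a3 := phiE ord0.
have phi1 : phi`_1 = dlin b1 b2 b3 := phiE ord_max.
have vE : dlin (a1 + b1) (a2 + b2) (a3 + b3 + c) =
    dlin a1 a2 a3 + dlin b1 b2 b3 + c%:MP.
  by rewrite /dlin -!mul_mpolyC; ring.
have PE : CR5_P c k l m n p q \mPo phi =
   - k%:MP * phi`_0 * phi`_1 ^+ 2 - l%:MP * phi`_1 + m%:MP * phi`_0 ^+ 2 * phi`_1
  - (n%:MP * phi`_0 * phi`_1 + p%:MP + q%:MP * (phi`_0 + phi`_1 + c%:MP) * phi`_0)
    * (2%:R * phi`_0 + phi`_1 + c%:MP).
  rewrite /CR5_P /CR5_T.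
  rewrite !(rmorphD, rmorphB, rmorphN, rmorphM, rmorphXn, rmorph_nat) /=.
  by rewrite !comp_mpolyC !comp_mpolyXU.
have QE : CR5_Q c k l m n p q \mPo phi =
  - phi`_0 * (l%:MP + p%:MP + m%:MP * c%:MP * phi`_0 + (k%:MP + n%:MP) * phi`_0 * phi`_1
         + m%:MP * phi`_0 ^+ 2 + q%:MP * (phi`_0 + phi`_1 + c%:MP) * phi`_0).
  rewrite /CR5_Q /CR5_T.
  rewrite !(rmorphD, rmorphB, rmorphN, rmorphM, rmorphXn, rmorph_nat) /=.
  by rewrite !comp_mpolyC !comp_mpolyXU.
rewrite PE QE phi0 phi1 vE -/a1 -/a2 -/b1 -/b2.
move: (dlin a1 a2 a3) (dlin b1 b2 b3) => X Y.
by rewrite -!mul_mpolyC; split; ring.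
Qed.

Lemma affine_pullback_id (PQ : {mpoly K[2]} * {mpoly K[2]}) :
  affine_pullback 1%:M 0 PQ = PQ.
Proof.
rewrite /affine_pullback; set phi := [tuple _ | _ < 2].
have -> : phi = [tuple 'X_i | i < 2].
  apply: eq_from_tnth => i; rewrite !tnth_mktuple (bigD1 i) //= big1 => [|j ji].
    by rewrite !mxE eqxx scale1r !addr0.
  by rewrite mxE eq_sym (negPf ji) scale0r.
by case: PQ => P Q; rewrite /= !comp_mpoly_id !mxE /= !scale1r !scale0r addr0 add0r.
Qed.

Lemma CR5_form_pullform (c k l m n p q : K) :
  form_of (CR5_form c k l m n p q) =
  pullform (line_pair (1, 0, 0) (0, 1, 0)) (line_pair (1, 0, 0) (1, 1, c))
    (- l) (- k) (- m) (- p) (m - n) (- q).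
Proof.
rewrite -[CR5_form _ _ _ _ _ _ _]affine_pullback_id form_of_affine_pullback !mxE /=.
by rewrite !addr0 !add0r.
Qed.
End CR5.

(** * Invariant conics of a general member *)

Section GenericMember.
Context {K : numClosedFieldType}.

(** The coordinates in the basis chosen by [poly_fun] are linear functions of the
    entries, so that D is rewritten in them by a linear substitution. *)
Lemma zariski_open_mpoly n (D : {mpoly K[n]}) :
  zariski_open (fun v : 'rV[K]_n => D.@[v ord0] != 0).
Proof.
set b := vbasis {: 'rV[K]_n}.
pose f := D \mPo [tuple \sum_(j < \dim {: 'rV[K]_n}) b`_j ord0 i *: 'X_j | i < n].
have fE v : poly_fun f v = D.@[v ord0].
  rewrite /poly_fun comp_mpoly_meval; apply: meval_eq => i.
  rewrite tnth_mktuple raddf_sum [in RHS](coord_vbasis (memvf v)) summxE.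
  by apply: eq_bigr => j _; rewrite /= mevalZ mevalXU mxE mulrC.
exists (fun g => g = f) => v; split=> [/negP|] Dv.
  by move=> _ ->; rewrite fE; apply/eqP; rewrite negbK in Dv.
by apply/negP; rewrite negbK -fE Dv.
Qed.

Lemma rank_le2P (M : 'M[K]_(4, 3)) :
  (\rank M <= 2)%N <-> exists2 mu : 'rV[K]_3, mu != 0 & mu *m M^T = 0.
Proof.
have -> : (\rank M <= 2)%N = (kermx M^T != 0).
  rewrite kermx_eq0 /row_free mxrank_tr.
  by rewrite -[LHS]ltnS ltn_neqAle rank_leq_col andbT.
split=> [/rowV0Pn[mu /sub_kermxP muM mu0]|[mu mu0 muM]]; first by exists mu.
by apply/rowV0Pn; exists mu => //; apply/sub_kermxP.
Qed.

Definition row3 (a b c : K) : 'rV[K]_3 := \row_i nth 0 [:: a; b; c] i.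

Lemma row3_eta (a : 'rV[K]_3) : a = row3 (a ord0 ix) (a ord0 iy) (a ord0 iz).
Proof. by apply/rowP; apply: ord3P; rewrite mxE. Qed.

Lemma ord4P (P : 'I_4 -> Prop) : (forall i : 'I_4, P i) <->
  [/\ P (inord 0), P (inord 1), P (inord 2) & P (inord 3)].
Proof.
split=> [Pi|[P0 P1 P2 P3] j]; first by split.
rewrite -[j]inord_val; case: j => [[|[|[|[|//]]]] lti] //=.
Qed.

Lemma CR5_rank_le2P k l m n p q (a20 a11 a00 : K) :
  (\rank (CR5_matrix k l m n p q (row3 a20 a11 a00)) <= 2)%N <->
  exists m1 m2 m3 : K, ~ [/\ m1 = 0, m2 = 0 & m3 = 0] /\
   [/\ a20 * m1 + q * m2 - (m + q) * m3 = 0,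
       - a11 * m1 + (m - n - q) * m2 + (k + n + q) * m3 = 0,
       a00 * m1 + p * m2 - (l + p) * m3 = 0 & a11 * m3 - a20 * m2 = 0].
Proof.
set M := CR5_matrix _ _ _ _ _ _ _.
have eqE (m1 m2 m3 : K) : row3 m1 m2 m3 *m M^T = 0 <->
   [/\ a20 * m1 + q * m2 - (m + q) * m3 = 0,
       - a11 * m1 + (m - n - q) * m2 + (k + n + q) * m3 = 0,
       a00 * m1 + p * m2 - (l + p) * m3 = 0 & a11 * m3 - a20 * m2 = 0].
  have -> : row3 m1 m2 m3 *m M^T = 0 <-> forall i, (row3 m1 m2 m3 *m M^T) ord0 i = 0.
    by split=> [->|E]; [move=> i; rewrite mxE | apply/rowP => i; rewrite E mxE].
  rewrite ord4P !mxE !sum_ord3 !mxE !inordK //=.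
  by split=> -[E0 E1 E2 E3]; split; [apply: etrans _ E0 | apply: etrans _ E1
    | apply: etrans _ E2 | apply: etrans _ E3 | apply: etrans _ E0 | apply: etrans _ E1
    | apply: etrans _ E2 | apply: etrans _ E3]; ring.
rewrite rank_le2P; split=> [[mu mu0 muM]|[m1 [m2 [m3 [nz]]]]].
  exists (mu ord0 ix), (mu ord0 iy), (mu ord0 iz); split.
    by move=> [E1 E2 E3]; move/eqP: mu0; apply; rewrite [mu]row3_eta E1 E2 E3;
       apply/rowP; apply: ord3P; rewrite !mxE.
  by apply/eqE; rewrite -row3_eta.
move/eqE => E; exists (row3 m1 m2 m3) => //.
by apply/eqP => /rowP z; apply: nz; split; [move: (z ix) | move: (z iy) | move: (z iz)];
  rewrite !mxE.
Qed.

Section Params.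
Variables c k l m n p q : K.
Local Notation u := (line_pair ((1 : K), (0 : K), (0 : K)) ((0 : K), (1 : K), (0 : K))).
Local Notation v := (line_pair ((1 : K), (0 : K), (0 : K)) ((1 : K), (1 : K), c)).

Lemma CR5_conicE (a20 a11 a00 : K) :
  CR5_conic c (row3 a20 a11 a00) = affine_in u v a00 (a11 - a20) a20.
Proof.
rewrite -[RHS](dehomogenizeK (affine_in_homog _ _ _ _ _)) /CR5_conic !mxE /=.
congr homogenize; rewrite /affine_in !quad_line_pair.
move: (dehomogenize_lin (1 : K) 0 0) (dehomogenize_lin (0 : K) 1 0).
move: (dehomogenize_lin 1 1 c).
move: (lin 1 0 0) (lin 0 1 0) (lin 1 1 c) => L M N NE LE ME.
rewrite expr2 !(dehomogenizeD, dehomogenizeM, dehomogenizeZ) LE ME NE dehomogenizeX /=.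
by rewrite /dlin !scale1r !scale0r mpolyC0 -!mul_mpolyC; ring.
Qed.

(** The eigenvector for lam, normalized by a20 = q; the last entry is determined by
    the others because lam is nonzero. *)
Definition eigen_row (lam : K) : 'rV[K]_3 :=
  row3 q (lam + m + q) ((- (l + p) * q + p * (lam + m + q)) / lam).

(** The characteristic equation of the linear part of the affine form, acting on
    (a20, a11). *)
Definition eigenvalue lam := lam ^+ 2 + (2 * m - n) * lam + (m * (m - n) + q * k) = 0.

Lemma eigen_row_cofactor lam : lam != 0 -> eigenvalue lam ->
  is_cofactor (form_of (CR5_form c k l m n p q)) (CR5_conic c (eigen_row lam))
    (- lam *: bracket u v).
Proof.
move=> lam0 ev; rewrite CR5_form_pullform CR5_conicE; apply: pull_cofactor.
- by field.
- by apply/eqP; rewrite -subr_eq0 -[X in _ == X]oppr0 -ev; apply/eqP; ring.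
- by ring.
Qed.

Lemma eigen_row_conic lam : q != 0 -> conic (CR5_conic c (eigen_row lam)).
Proof.
move=> q0; rewrite /conic CR5_conicE affine_in_homog; split=> //.
apply/eqP => /(congr1 (meval (fun i : 'I_3 => (i == ix)%:R))).
rewrite /affine_in !mevalD !mevalZ !meval_quad expr2 mevalM mevalXU meval0 /=.
by rewrite !(mulr0, mul0r, expr2, addr0, mulr1, add0r) => /eqP; apply/negP.
Qed.

Lemma mderiv_pullform_curl u' v' (e0 e1 e2 h0 h1 h2 : K) :
  let w := pullform u' v' e0 e1 e2 h0 h1 h2 in
  (formQ w)^`M(ix) - (formP w)^`M(iy) = (h1 - e2) *: bracket u' v'.
Proof.
rewrite /= formP_pull formQ_pull /pullcoef !mderivD !mderivM !mderiv_affine_in //.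
rewrite /bracket (mderiv_comm iy ix (quad u')) (mderiv_comm iy ix (quad v')).
move: ((quad u')^`M(ix)^`M(iy)) ((quad v')^`M(ix)^`M(iy)) => Uxy Vxy.
by rewrite -!mul_mpolyC; ring.
Qed.

(** The last row of the matrix says that the coefficients of the second and third
    columns in a linear relation are proportional to a11 and a20; the other three
    rows then form the eigenvector equation. *)
Lemma eigen_row_rank lam1 lam2 (a' : 'rV[K]_3) :
  q != 0 -> lam1 != 0 -> lam2 != 0 ->
  lam1 + lam2 = n - 2 * m -> lam1 * lam2 = m * (m - n) + q * k -> a' != 0 ->
  (\rank (CR5_matrix k l m n p q a') <= 2)%N <->
  exists s, a' = s *: eigen_row lam1 \/ a' = s *: eigen_row lam2.
Proof.
move=> q0 lam10 lam20 sumE prodE a0.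
have det0 : m * (m - n) + q * k != 0 by rewrite -prodE mulf_neq0.
rewrite {1}[a']row3_eta CR5_rank_le2P.
set a20 := a' ord0 ix; set a11 := a' ord0 iy; set a00 := a' ord0 iz.
split=> [[m1 [m2 [m3 [nz [E0 E1 E2 E3]]]]]|].
  have [t [m2E m3E a200]] : exists t, [/\ m2 = t * a11, m3 = t * a20 & a20 != 0].
    case: (eqVneq a20 0) => [a20z|a200]; last first.
      exists (m3 / a20); split=> //; last by rewrite divfK.
      move/eqP: E3; rewrite subr_eq0 => /eqP E3.
      by rewrite mulrAC [m3 * _]mulrC E3 mulrC mulKf.
    case: nz; move: E0 E1 E2 E3; rewrite a20z mul0r add0r mul0r subr0 => E0 E1 E2 E3.
    case: (eqVneq a11 0) => [a11z|a110]; last first.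
      have m30 : m3 = 0 by move/eqP: E3; rewrite mulf_eq0 (negPf a110) => /eqP.
      have m20 : m2 = 0.
        by move/eqP: E0; rewrite m30 mulr0 subr0 mulf_eq0 (negPf q0) => /eqP.
      split=> //; move/eqP: E1; rewrite m20 m30 !mulr0 !addr0 mulf_eq0 oppr_eq0.
      by rewrite (negPf a110) => /eqP.
    have m30 : m3 = 0.
      suff /eqP : (m * (m - n) + q * k) * m3 = 0.
        by rewrite mulf_eq0 (negPf det0) => /eqP.
      transitivity (q * (- a11 * m1 + (m - n - q) * m2 + (k + n + q) * m3)
                    - (m - n - q) * (q * m2 - (m + q) * m3)).
        by rewrite a11z; ring.
      by rewrite E0 E1 !mulr0 subr0.
    have m20 : m2 = 0.
      by move/eqP: E0; rewrite m30 mulr0 subr0 mulf_eq0 (negPf q0) => /eqP.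
    split=> //; move/eqP: E2; rewrite m20 m30 !mulr0 addr0 subr0 mulf_eq0.
    have a000 : a00 != 0.
      apply: contra_neq a0 => a00z; rewrite [LHS]row3_eta -/a20 -/a11 -/a00.
      rewrite a20z a11z a00z.
      by apply/rowP; apply: ord3P; rewrite !mxE.
    by rewrite (negPf a000) => /eqP.
  have t0 : t != 0.
    apply/eqP => t0; apply: nz; rewrite m2E m3E t0 !mul0r; split=> //.
    move: E0; rewrite m2E m3E t0 !mul0r !mulr0 addr0 subr0 => /eqP.
    by rewrite mulf_eq0 (negPf a200) => /eqP.
  (* The relation is normalized by t = 1; lam is then the eigenvalue. *)
  pose lam := - m1 / t.
  have m1E : m1 = - lam * t by rewrite /lam !mulNr opprK divfK.
  have F0 : a11 * q = (lam + m + q) * a20.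
    apply: (mulfI t0); apply/eqP; rewrite -subr_eq0 -[X in _ == X]E0; apply/eqP.
    by rewrite m1E m2E m3E; ring.
  have F1 : eigenvalue lam.
    apply: (mulfI a200); apply: (mulfI t0); rewrite mulr0 mulr0.
    transitivity (q * (- a11 * m1 + (m - n - q) * m2 + (k + n + q) * m3)
       - t * (lam + m - n - q) * (a11 * q - (lam + m + q) * a20)).
      by rewrite m1E m2E m3E; ring.
    by rewrite E1 F0 subrr !mulr0 subr0.
  have F2 : lam * a00 = - (l + p) * a20 + p * a11.
    apply: (mulfI t0); apply/eqP; rewrite eq_sym -subr_eq0 -[X in _ == X]E2; apply/eqP.
    by rewrite m1E m2E m3E; ring.
  have eigE lam' : lam' != 0 -> lam = lam' -> a' = (a20 / q) *: eigen_row lam'.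
    move=> lam'0 lamE; rewrite [LHS]row3_eta -/a20 -/a11 -/a00.
    apply/rowP; apply: ord3P; rewrite !mxE /=.
    - by rewrite divfK.
    - by rewrite -lamE mulrAC [a20 * _]mulrC -F0 mulfK.
    - apply: (mulfI lam'0); rewrite -{1}lamE F2 -lamE.
      have -> : a11 = (lam + m + q) * a20 / q by rewrite -F0 mulfK.
      by rewrite lamE; field; rewrite q0 lam'0.
  have : (lam - lam1) * (lam - lam2) = 0.
    transitivity (lam ^+ 2 - (lam1 + lam2) * lam + lam1 * lam2); first by ring.
    by rewrite sumE prodE -[RHS]F1; ring.
  move/eqP; rewrite mulf_eq0 !subr_eq0 => /orP[] /eqP lamE.
    by exists (a20 / q); left; apply: eigE.
  by exists (a20 / q); right; apply: eigE.
case=> s aE; have [lam [lam0 ev aE']] : exists lam, [/\ lam != 0, eigenvalue lam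
    & a' = s *: eigen_row lam].
  case: aE => ->; [exists lam1 | exists lam2]; split=> //; rewrite /eigenvalue -prodE;
    by rewrite -[2 * m - n]opprB -sumE; ring.
exists (- lam), a11, a20; split.
  by case=> /eqP; rewrite oppr_eq0 (negPf lam0).
rewrite /a20 /a11 /a00 aE' !mxE /=; split; try by ring.
- by rewrite -(mulr0 s) -[in RHS]ev; ring.
- by field.
Qed.
End Params.
End GenericMember.

(** * The two assertions *)

Section Main.
Context {K : numClosedFieldType}.

Lemma X_CR5_closure (w : V3 K) : X_CR5 w -> zariski_closure X22 w.
Proof.
case=> [[c [k [l [m [n [p [q [A [t [_ ->]]]]]]]]]]].
by rewrite form_of_affine_pullback; apply: poincare_pullform_closure.
Qed.

Definition params c k l m n p q : 'rV[K]_7 :=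
  \row_(i < 7) nth 0 [:: c; k; l; m; n; p; q] i.

(** The coefficient q, which is the first entry of the eigenvectors, the determinant
    of the 2 x 2 block acting on (a20, a11), and the discriminant of its
    characteristic polynomial. *)
Definition genericity : {mpoly K[7]} :=
  let k := 'X_(inord 1) in let m := 'X_(inord 3) in
  let n := 'X_(inord 4) in let q := 'X_(inord 6) in
  q * (m * (m - n) + q * k) * ((n - 2%:R * m) ^+ 2 - 4%:R * (m * (m - n) + q * k)).

Lemma meval_genericity c k l m n p q : genericity.@[params c k l m n p q ord0] =
  q * (m * (m - n) + q * k) * ((n - 2 * m) ^+ 2 - 4 * (m * (m - n) + q * k)).
Proof.
rewrite /genericity expr2 !(mevalM, mevalB, mevalD, mevalMn, mevalXU, meval1) !mxE.
by rewrite !inordK //= expr2.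
Qed.

Lemma generic_CR5_conics c k l m n p q :
  genericity.@[params c k l m n p q ord0] != 0 ->
  let w := form_of (CR5_form c k l m n p q) in
  exists a b : 'rV[K]_3,
    [/\ [/\ a != 0, b != 0 & ~ exists s : K, b = s *: a],
        forall a' : 'rV[K]_3, a' != 0 ->
          ((\rank (CR5_matrix k l m n p q a') <= 2)%N <->
           exists s : K, a' = s *: a \/ a' = s *: b),
        conic (CR5_conic c a) /\ integral_curve w (CR5_conic c a),
        conic (CR5_conic c b) /\ integral_curve w (CR5_conic c b)
      & darboux_integrable w [tuple CR5_conic c a; CR5_conic c b]].
Proof.
rewrite meval_genericity !mulf_eq0 !negb_or => /andP[/andP[q0 det0] disc0] w.
have [lam1 [lam2 [sumE prodE]]] := sum_prod_exists (n - 2 * m) (m * (m - n) + q * k).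
have lam10 : lam1 != 0 by apply: contra_neq det0; rewrite -prodE => ->; rewrite mul0r.
have lam20 : lam2 != 0 by apply: contra_neq det0; rewrite -prodE => ->; rewrite mulr0.
have ev lam : lam = lam1 \/ lam = lam2 -> eigenvalue k m n q lam.
  by rewrite /eigenvalue -prodE -[2 * m - n]opprB -sumE; case=> ->; ring.
set a := eigen_row l m p q lam1; set b := eigen_row l m p q lam2.
have row_neq0 lam : eigen_row l m p q lam != 0.
  by apply/eqP => /rowP/(_ ix)/eqP; rewrite !mxE /= (negPf q0).
have cofa := @eigen_row_cofactor K c k l m n p q lam1 lam10 (ev _ (or_introl erefl)).
have cofb := @eigen_row_cofactor K c k l m n p q lam2 lam20 (ev _ (or_intror erefl)).
have curve lam : is_cofactor w (CR5_conic c (eigen_row l m p q lam)) _ ->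
    integral_curve w (CR5_conic c (eigen_row l m p q lam)).
  move=> cof; have [F0 F2] := eigen_row_conic c l m p lam q0.
  by split=> //; [exists 2%N | eexists; apply: cof].
exists a, b; split.
- split; rewrite ?row_neq0 //; case=> s /rowP ba.
  have := ba ix; rewrite !mxE /= => /eqP; rewrite -subr_eq0 -{1}[q]mul1r -mulrBl.
  rewrite mulf_eq0 (negPf q0) orbF subr_eq0 => /eqP s1.
  have := ba iy; rewrite !mxE /= -s1 mul1r => /addIr/addIr lamE.
  by move/eqP: disc0; apply; rewrite -sumE -prodE lamE; ring.
- by move=> a' a'0; apply: eigen_row_rank.
- by split; [exact: eigen_row_conic | apply: curve cofa].
- by split; [exact: eigen_row_conic | apply: curve cofb].
split.
  case=> -[|[|//]] lti; rewrite (tnth_nth 0) /=.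
    exact: curve cofa.
  exact: curve cofb.
set br := bracket _ _ in cofa cofb.
exists (fun i => - ([:: lam1; lam2]`_i) *: br), (fun=> 1); split.
  by case=> -[|[|//]] lti; rewrite (tnth_nth 0).
rewrite !big_ord_recl big_ord0 /= !scale1r addr0 /w CR5_form_pullform.
rewrite mderiv_pullform_curl -scalerDl; congr (_ *: _).
by rewrite -opprD sumE; ring.
Qed.

(** For k = q = 1 and the other parameters zero the value is - 4. *)
Lemma genericity_nonvanishing : exists v : 'rV[K]_7, genericity.@[v ord0] != 0.
Proof.
exists (params 0 1 0 0 0 0 1); rewrite meval_genericity.
have -> : forall e : K, e = - 4 -> e != 0 by move=> e ->; rewrite oppr_eq0 pnatr_eq0.
  by [].
by ring.
Qed.

End Main.

Local Open Scope complex_scope.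

Theorem proposition6p9 (R : realType) :
  (exists U : 'rV[R[i]]_7 -> Prop,
     [/\ zariski_open U,
         exists v, U v
       & forall c k l m n p q : R[i],
           U (\row_(i < 7) nth 0 [:: c; k; l; m; n; p; q] i) ->
           let w := form_of (CR5_form c k l m n p q) in
           exists a b : 'rV[R[i]]_3,
             [/\ [/\ a != 0, b != 0 & ~ exists s : R[i], b = s *: a],
                 forall a' : 'rV[R[i]]_3, a' != 0 ->
                   ((\rank (CR5_matrix k l m n p q a') <= 2)%N <->
                    exists s : R[i], a' = s *: a \/ a' = s *: b),
                 conic (CR5_conic c a) /\ integral_curve w (CR5_conic c a),
                 conic (CR5_conic c b) /\ integral_curve w (CR5_conic c b)
               & darboux_integrable w [tuple CR5_conic c a; CR5_conic c b]]])
  /\ (forall w : V3 R[i], X_CR5 w -> zariski_closure X22 w).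
Proof.
split; last exact: X_CR5_closure.
exists (fun v => genericity.@[v ord0] != 0); split.
- exact: zariski_open_mpoly.
- exact: genericity_nonvanishing.
- exact: generic_CR5_conics.
Qed.
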